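(* If there is a polynomial-time $f$-approximation algorithm for MFASP, then there is a polynomial-time $2f$-approximation algorithm for the Minimum $k$-Edge Coverage problem.
   Context: All graphs are finite, undirected and simple. For a graph $G=(V,E)$ with unit edge weights and $w\in\mathbb{R}^E_{\ge 0}$, a fractional $w$-vertex cover is $y\in\mathbb{R}^V_{\ge 0}$ with $y_u+y_v\ge w_{uv}$ for all $\{u,v\}\in E$; $\nu(G,w)$ is the maximum $w$-weight of a matching, $\tau_f(G,w)$ the minimum of $\sum_v y_v$ over fractional $w$-vertex covers; $(G,w)$ is stable if $\nu(G,w)=\tau_f(G,w)$. MFASP: given $G$, find $c\in\mathbb{R}^E_{\ge0}$ with $(G,\mathbb{1}+c)$ stable minimizing $\sum_e c_e$. Minimum $k$-Edge Coverage: given a graph and an integer $k$, find a minimum number of vertices whose induced subgraph has at least $k$ edges. *)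

(* Defs.v *)
From HB Require Import structures.
From mathcomp Require Import all_boot all_order all_algebra.
From mathcomp Require Import reals.

Set Implicit Arguments.
Unset Strict Implicit.
Unset Printing Implicit Defensive.

Import Order.TTheory GRing.Theory Num.Theory.

Local Open Scope nat_scope.

(** * Polynomial time

    Algorithms are programs of the WHILE language on binary trees (N. D. Jones,
    _Computability and Complexity from a Programming Perspective_, MIT Press,
    1997).  In the unit-cost version of that language [X := cons X X] builds
    exponentially large trees; here every assignment is charged the size of the
    assigned value.  Hence every value in the store is either the
    input or has size at most the running time, and the language and multitape
    Turing machines simulate each other with polynomial overhead. *)

Inductive tree := Leaf | Node of tree & tree.

Fixpoint tsize (t : tree) : nat :=
  if t is Node a b then (tsize a + tsize b).+1 else 1.

Definition hd (t : tree) := if t is Node a _ then a else Leaf.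
Definition tl (t : tree) := if t is Node _ b then b else Leaf.
Definition truthy (t : tree) : bool := if t is Node _ _ then true else false.

Definition var := nat.

Inductive expr :=
| EVar of var
| ENil
| ECons of expr & expr
| EHd of expr
| ETl of expr.

Inductive cmd :=
| CSkip
| CAssign of var & expr
| CSeq of cmd & cmd
| CIf of expr & cmd & cmd
| CWhile of expr & cmd.

Definition store := var -> tree.

Definition upd (s : store) (x : var) (v : tree) : store :=
  fun y => if y == x then v else s y.

Fixpoint eval (s : store) (e : expr) : tree :=
  match e with
  | EVar x => s x
  | ENil => Leaf
  | ECons a b => Node (eval s a) (eval s b)
  | EHd a => hd (eval s a)
  | ETl a => tl (eval s a)
  end.

(** [exec p s s' t]: started in [s], the program [p] halts in [s'] after time
    exactly [t]. *)
Inductive exec : cmd -> store -> store -> nat -> Prop :=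
| exec_skip s : exec CSkip s s 1
| exec_assign s x e :
    exec (CAssign x e) s (upd s x (eval s e)) (tsize (eval s e)).+1
| exec_seq p q s s1 s2 t1 t2 :
    exec p s s1 t1 -> exec q s1 s2 t2 -> exec (CSeq p q) s s2 (t1 + t2).+1
| exec_if e p q s s' t :
    exec (if truthy (eval s e) then p else q) s s' t ->
    exec (CIf e p q) s s' t.+1
| exec_while_stop e p s :
    ~~ truthy (eval s e) -> exec (CWhile e p) s s 1
| exec_while_step e p s s1 s2 t1 t2 :
    truthy (eval s e) -> exec p s s1 t1 -> exec (CWhile e p) s1 s2 t2 ->
    exec (CWhile e p) s s2 (t1 + t2).+1.

(** Input and output are held by variable 0; the other variables start at
    [Leaf]. *)
Definition runs (p : cmd) (input output : tree) (t : nat) : Prop :=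
  exists2 s : store, exec p (upd (fun=> Leaf) 0 input) s t & s 0 = output.

(** * Encodings *)

Definition enc_list (s : seq tree) : tree := foldr Node Leaf s.

Definition enc_bool (b : bool) : tree := if b then Node Leaf Leaf else Leaf.

Definition enc_bits (bs : seq bool) : tree := enc_list (map enc_bool bs).

(** Binary numerals have the least significant bit first; leading zeros, at
    the end of the list, are allowed in [bits_val] and absent from [nat_bits]. *)
Definition bits_val (bs : seq bool) : nat :=
  foldr (fun (b : bool) m => b + m.*2) 0 bs.

Definition nat_bits (k : nat) : seq bool :=
  mkseq (fun i => odd (k %/ 2 ^ i)) (up_log 2 k.+1).

Definition enc_matrix (n : nat) (M : 'I_n -> 'I_n -> tree) : tree :=
  enc_list [seq enc_list [seq M i j | j <- enum 'I_n] | i <- enum 'I_n].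

(** * Minimization problems and approximation algorithms *)

Record min_problem (R : realType) := MinProblem {
  instance : Type;
  solution : instance -> Type;
  feasible : forall i : instance, solution i -> Prop;
  cost : forall i : instance, solution i -> R;
  enc_instance : instance -> tree;
  represents : forall i : instance, tree -> solution i -> Prop
}.

(** The program must halt in polynomial time on every instance; its output is
    unconstrained on instances without feasible solution. *)
Definition poly_approx (R : realType) (P : min_problem R) (f : R) : Prop :=
  exists (p : cmd) (time : {poly nat}), forall i : instance P,
  exists (out : tree) (t : nat),
    [/\ runs p (enc_instance i) out t,
        t <= time.[tsize (enc_instance i)]%R
      & (exists s : solution i, feasible s) ->
        exists s : solution i,
          [/\ represents out s, feasible s
            & forall s' : solution i, feasible s' ->
                (cost s <= f * cost s')%R]].

(** * Graphs *)

Record sgraph := SGraph {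
  nvert : nat;
  adj : rel 'I_nvert;
  adj_sym : symmetric adj;
  adj_irr : irreflexive adj
}.

Definition vertex (G : sgraph) : finType := 'I_(nvert G).

Definition edges (G : sgraph) : {set {set vertex G}} :=
  [set e | [exists u : vertex G, exists v : vertex G,
              adj u v && (e == [set u; v])]].

Definition enc_graph (G : sgraph) : tree :=
  enc_matrix (fun i j => enc_bool (@adj G i j)).

Definition matching (G : sgraph) (M : {set {set vertex G}}) : bool :=
  (M \subset edges G) && trivIset M.

Local Open Scope ring_scope.

(** A vector in R^E is a function on all sets of vertices, of which only the
    values on [edges G] are ever used. *)
Definition weighting (R : realType) (G : sgraph) := {set vertex G} -> R.

(** The default value 0 is the weight of the empty matching. *)
Definition nu (R : realType) (G : sgraph) (w : weighting R G) : R :=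
  \big[Num.max/0]_(M : {set {set vertex G}} | matching M) \sum_(e in M) w e.

Definition frac_cover (R : realType) (G : sgraph) (w : weighting R G)
    (y : vertex G -> R) : Prop :=
  (forall v, 0 <= y v) /\
  (forall u v : vertex G, adj u v -> w [set u; v] <= y u + y v).

Definition is_tau_f (R : realType) (G : sgraph) (w : weighting R G) (t : R) :=
  (exists2 y : vertex G -> R, frac_cover w y & \sum_v y v = t) /\
  (forall y : vertex G -> R, frac_cover w y -> t <= \sum_v y v).

Definition stable (R : realType) (G : sgraph) (w : weighting R G) : Prop :=
  is_tau_f w (nu w).

(** * The two problems *)

Definition frac_additive_stabilizer (R : realType) (G : sgraph)
    (c : weighting R G) : Prop :=
  (forall e, e \in edges G -> 0 <= c e) /\ stable (fun e => 1 + c e).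

(** The output is a matrix of pairs (numerator, denominator), not necessarily
    in lowest terms; entries outside the edge set are ignored. *)
Definition represents_weighting (R : realType) (G : sgraph) (out : tree)
    (c : weighting R G) : Prop :=
  exists num den : vertex G -> vertex G -> seq bool,
    out = enc_matrix (fun i j =>
            Node (enc_bits (num i j)) (enc_bits (den i j))) /\
    forall i j : vertex G, adj i j ->
      (0 < bits_val (den i j))%N /\
      c [set i; j] = (bits_val (num i j))%:R / (bits_val (den i j))%:R.

Definition MFASP (R : realType) : min_problem R :=
  @MinProblem R sgraph (fun G => weighting R G)
    (fun G c => frac_additive_stabilizer c)
    (fun G c => \sum_(e in edges G) c e)
    enc_graph
    (fun G out c => represents_weighting out c).

Definition min_k_edge_coverage (R : realType) : min_problem R :=
  @MinProblem R (sgraph * nat)%type (fun Gk => {set vertex Gk.1})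
    (fun Gk S => (Gk.2 <= #|[set e in edges Gk.1 | e \subset S]|)%N)
    (fun Gk S => #|S|%:R)
    (fun Gk => Node (enc_graph Gk.1) (enc_bits (nat_bits Gk.2)))
    (fun Gk out S => out = enc_bits [seq i \in S | i <- enum 'I_(nvert Gk.1)]).

(* Main.v *)
(** From a graph [H] with [m] edges and an integer [k], build a graph with
    - a vertex [x_e] for each edge [e] of [H];
    - [m - k] absorbers, each adjacent to all the [x_e];
    - for each vertex [u] of [H], [t] disjoint cliques [K_2r], where a single
      vertex of each clique, its port, is adjacent to the [x_e] with [u \in e].
    A stabilizer [c] comes with a matching [M] and a fractional cover [y] of the
    same weight, so [y] vanishes on the vertices that [M] exposes.  If [M] matches
    every clique perfectly inside itself, then at least [k] of the [x_e] are
    exposed; the ports next to them have [y >= 1], and such a port forces an edge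
    with [c >= 1/3] in its clique.  Let [S] be the set of the [u] all of whose [t]
    cliques contain such an edge: it covers [k] edges and [c] costs at least
    [t #|S| / 3].  If some clique is not matched inside itself, it contains an
    exposed vertex other than its port, and [c] costs at least [r - 1 >= t n], so
    that the set of all vertices is cheap enough to be output.  Conversely, a set
    [S] covering [k] edges gives a stabilizer of cost at most
    [(m - k) / 2 + t #|S| / 2 <= 2 / 3 t #|S|] once [t >= 3 m]: put [y = 1] on the
    absorbers and the ports of [S], [y = 0] on [k] of the [x_e], and [y = 1/2]
    elsewhere.  The ratio of the two bounds is [2].

    The reduction and the extraction of [S] are polynomial-time because the
    functions on trees computed by WHILE programs in polynomial time are closed
    under composition, pairing, conditionals and right folds whose accumulator
    grows by a polynomially bounded amount at each step. *)

Require Import Defs.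
From HB Require Import structures.
From mathcomp Require Import all_boot all_order all_algebra zify lra.
From mathcomp Require Import reals.

Set Implicit Arguments.
Unset Strict Implicit.
Unset Printing Implicit Defensive.

(* [tuple.tsize] would otherwise hide [Defs.tsize]. *)
Import Defs.
Import Order.TTheory GRing.Theory Num.Theory.

Local Open Scope nat_scope.

(** * Polynomial-time tree functions *)

Definition ev (q : {poly nat}) (n : nat) : nat := q.[n]%R.

(** Domination by a polynomial, and not equality with one, so that running times may be any
    convenient arithmetic expressions. *)
Definition polyb (g : nat -> nat) := exists q : {poly nat}, forall n, g n <= ev q n.

Lemma ev_mono (q : {poly nat}) m n : m <= n -> ev q m <= ev q n.
Proof.
rewrite /ev => le_mn; elim/poly_ind: q => [|q c IHq]; first by rewrite !horner0.
rewrite !hornerMXaddC; apply: leq_add => //.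
exact: leq_mul.
Qed.

Lemma polyb_horner (q : {poly nat}) : polyb (ev q).
Proof. by exists q. Qed.

Lemma polyb_id : polyb id.
Proof. by exists 'X%R => n; rewrite /ev hornerX. Qed.

Lemma polyb_const k : polyb (fun=> k).
Proof. by exists (k%:P)%R => n; rewrite /ev hornerC. Qed.

Lemma polyb_add g h : polyb g -> polyb h -> polyb (fun n => g n + h n).
Proof.
move=> [p gp] [q hq]; exists (p + q)%R => n.
by rewrite /ev hornerD; apply: leq_add.
Qed.

Lemma polyb_mul g h : polyb g -> polyb h -> polyb (fun n => g n * h n).
Proof.
move=> [p gp] [q hq]; exists (p * q)%R => n.
by rewrite /ev hornerM; apply: leq_mul.
Qed.

Lemma polyb_comp (q : {poly nat}) h : polyb h -> polyb (fun n => ev q (h n)).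
Proof.
move=> [p hp]; exists (q \Po p)%R => n.
by rewrite /ev horner_comp; apply: ev_mono.
Qed.

Lemma polyb_S g : polyb g -> polyb (fun n => (g n).+1).
Proof. by move=> hg; case: (polyb_add (polyb_const 1) hg) => q hq; exists q. Qed.

Ltac polyb_tac := repeat first
  [ exact: polyb_id | exact: polyb_const | exact: polyb_horner
  | apply: polyb_S | apply: polyb_add | apply: polyb_mul | apply: polyb_comp ].

Lemma tsize_hd t : tsize (hd t) <= tsize t.
Proof. by case: t => //= a b; lia. Qed.

Lemma tsize_tl t : tsize (tl t) <= tsize t.
Proof. by case: t => //= a b; lia. Qed.

(* Argument and value are in variable 0.  The program starts from an arbitrary store and
   keeps the variables above [N], where a caller can save its own data. *)
Definition polyt (F : tree -> tree) := exists (p : cmd) (N : nat) (g : nat -> nat),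
  polyb g /\ forall s, exists s' t,
    [/\ exec p s s' t, s' 0 = F (s 0), (forall y, N < y -> s' y = s y),
        t <= g (tsize (s 0)) & tsize (F (s 0)) <= g (tsize (s 0))].

(** Polynomials with natural coefficients are monotone ([ev_mono]), while [g] may fail to be;
    monotonicity is what lets bounds compose. *)
Lemma polytE F : polyt F -> exists (p : cmd) (N : nat) (q : {poly nat}),
  forall s, exists s' t,
    [/\ exec p s s' t, s' 0 = F (s 0), (forall y, N < y -> s' y = s y),
        t <= ev q (tsize (s 0)) & tsize (F (s 0)) <= ev q (tsize (s 0))].
Proof.
move=> [p [N [g [[q hq] hp]]]]; exists p, N, q => s.
have [s' [t [h1 h2 h3 h4 h5]]] := hp s; exists s', t; split=> //.
  exact: leq_trans h4 (hq _).
exact: leq_trans h5 (hq _).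
Qed.

Lemma polyt_size F : polyt F -> exists q : {poly nat}, forall x, tsize (F x) <= ev q (tsize x).
Proof.
move=> /polytE [p [N [q hp]]]; exists q => x.
by have [s' [t [_ _ _ _]]] := hp (fun=> x).
Qed.

Lemma polyt_ext F G : F =1 G -> polyt F -> polyt G.
Proof.
move=> FG [p [N [g [hg hp]]]]; exists p, N, g; split=> // s.
by have := hp s; rewrite FG.
Qed.

Lemma polyt_expr e F : (forall s, eval s e = F (s 0)) ->
  (exists q : {poly nat}, forall x, tsize (F x) <= ev q (tsize x)) -> polyt F.
Proof.
move=> eF [q hq]; exists (CAssign 0 e), 0, (fun n => (ev q n).+1).
split; first by polyb_tac.
move=> s; exists (upd s 0 (eval s e)), (tsize (eval s e)).+1; split.
- exact: exec_assign.
- by rewrite /upd eqxx eF.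
- by move=> y y0; rewrite /upd gtn_eqF.
- by rewrite eF ltnS.
- exact/leqW.
Qed.

Lemma polyt_id : polyt id.
Proof.
apply: (polyt_expr (e := EVar 0)) => //.
by exists 'X%R => x; rewrite /ev hornerX.
Qed.

Lemma polyt_leaf : polyt (fun=> Leaf).
Proof.
apply: (polyt_expr (e := ENil)) => //.
by exists (1%N%:P)%R => x; rewrite /ev hornerC.
Qed.

Lemma polyt_comp F G : polyt F -> polyt G -> polyt (fun x => F (G x)).
Proof.
move=> /polytE [p [N [q hp]]] /polytE [p' [N' [q' hp']]].
exists (CSeq p' p), (maxn N N'), (fun n => (ev q' n + ev q (ev q' n)).+1).
split; first by polyb_tac.
move=> s; have [s1 [t1 [e1 v1 f1 b1 c1]]] := hp' s.
have [s2 [t2 [e2 v2 f2 b2 c2]]] := hp s1.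
have m := ev_mono q c1.
exists s2, (t1 + t2).+1; split.
- exact: exec_seq e1 e2.
- by rewrite v2 v1.
- by move=> y; rewrite gtn_max => /andP[h1 h2]; rewrite f2 ?f1.
- rewrite ltnS; apply: leq_add => //; apply: leq_trans b2 _; by rewrite v1.
- rewrite -v1; apply: leq_trans c2 _; rewrite v1; apply: leq_trans m _.
  exact/leqW/leq_addl.
Qed.

Lemma polyt_node F G : polyt F -> polyt G -> polyt (fun x => Node (F x) (G x)).
Proof.
move=> /polytE [p [N [q hp]]] /polytE [p' [N' [q' hp']]].
pose K := (maxn N N').+1.
have KN : N < K by rewrite ltnS leq_maxl.
have KN' : N' < K by rewrite ltnS leq_maxr.
(* [K] keeps the argument while [p] runs, and [K.+1] keeps [F x] while [p'] runs; both lie above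
   everything that [p] and [p'] alter. *)
exists (CSeq (CAssign K (EVar 0)) (CSeq p (CSeq (CAssign K.+1 (EVar 0))
  (CSeq (CAssign 0 (EVar K)) (CSeq p' (CAssign 0 (ECons (EVar K.+1) (EVar 0)))))))), K.+1,
  (fun n => 20 + n + n + ev q n + ev q n + ev q n + ev q' n + ev q' n + ev q' n).
split; first by polyb_tac.
move=> s; set x := s 0.
pose s0 := upd s K x.
have [s1 [t1 [e1 v1 f1 b1 c1]]] := hp s0.
pose s2 := upd s1 K.+1 (s1 0).
pose s3 := upd s2 0 (s2 K).
have s3x : s3 0 = x.
  rewrite /s3 /upd eqxx /s2 /upd ltn_eqF // f1 // /s0 /upd eqxx //.
have [s4 [t4 [e4 v4 f4 b4 c4]]] := hp' s3.
have s0x : s0 0 = x by rewrite /s0 /upd.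
rewrite s0x in v1 b1 c1; rewrite s3x in v4 b4 c4.
have s4K : s4 K.+1 = F x.
  by rewrite f4 1?ltnW // /s3 /upd /= /s2 /upd eqxx.
exists (upd s4 0 (Node (s4 K.+1) (s4 0))); eexists; split.
- apply: exec_seq; first exact: exec_assign.
  apply: exec_seq; first exact: e1.
  apply: exec_seq; first exact: exec_assign.
  apply: exec_seq; first exact: exec_assign.
  apply: exec_seq; first exact: e4.
  exact: exec_assign.
- by rewrite /upd eqxx s4K v4.
- move=> y hy; rewrite /upd gtn_eqF ?(leq_ltn_trans _ hy) //.
  have Ky : K < y by apply: ltnW.
  rewrite f4 ?(ltn_trans KN') // /s3 /upd gtn_eqF ?(leq_ltn_trans _ hy) //.
  by rewrite /s2 /upd gtn_eqF // f1 ?(ltn_trans KN) // /s0 /upd gtn_eqF.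
- rewrite /= s4K v4 v1 -/x /upd ltn_eqF // f1 // /s0 /upd eqxx; lia.
- rewrite /=; lia.
Qed.

Lemma polyt_hd F : polyt F -> polyt (fun x => hd (F x)).
Proof.
move=> hF; apply: (polyt_comp (F := hd)) => //.
apply: (polyt_expr (e := EHd (EVar 0))) => //.
by exists 'X%R => x; rewrite /ev hornerX tsize_hd.
Qed.

Lemma polyt_tl F : polyt F -> polyt (fun x => tl (F x)).
Proof.
move=> hF; apply: (polyt_comp (F := tl)) => //.
apply: (polyt_expr (e := ETl (EVar 0))) => //.
by exists 'X%R => x; rewrite /ev hornerX tsize_tl.
Qed.

Lemma polyt_if B F G : polyt B -> polyt F -> polyt G ->
  polyt (fun x => if truthy (B x) then F x else G x).
Proof.
move=> /polytE [pB [NB [qB hB]]] /polytE [p [N [q hp]]] /polytE [p' [N' [q' hp']]].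
pose K := (maxn NB (maxn N N')).+1.
have KB : NB < K by rewrite /K; lia.
have KN : N < K by rewrite /K; lia.
have KN' : N' < K by rewrite /K; lia.
exists (CSeq (CAssign K (EVar 0)) (CSeq pB (CSeq (CAssign K.+1 (EVar 0))
  (CSeq (CAssign 0 (EVar K)) (CIf (EVar K.+1) p p'))))), K.+1,
  (fun n => 20 + n + n + ev qB n + ev qB n + ev q n + ev q' n).
split; first by polyb_tac.
move=> s; set x := s 0.
pose s0 := upd s K x.
have [s1 [t1 [e1 v1 f1 b1 c1]]] := hB s0.
pose s2 := upd s1 K.+1 (s1 0).
pose s3 := upd s2 0 (s2 K).
have s0x : s0 0 = x by rewrite /s0 /upd.
rewrite s0x in v1 b1 c1.
have s3x : s3 0 = x.
  rewrite /s3 /upd eqxx /s2 /upd ltn_eqF // f1 // /s0 /upd eqxx //.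
have s3K : s3 K.+1 = B x by rewrite /s3 /upd /= /s2 /upd eqxx.
have f3 y : K.+1 < y -> s3 y = s y.
  move=> hy; rewrite /s3 /upd gtn_eqF ?(leq_ltn_trans _ hy) //.
  by rewrite /s2 /upd gtn_eqF // f1 ?(ltn_trans KB) 1?ltnW // /s0 /upd gtn_eqF // ltnW.
(* Both branches satisfy one specification, whose bound is the sum of theirs. *)
have [s4 [t4 [e4 v4 f4 b4 c4]]] : exists s4 t4, [/\ exec (if truthy (B x) then p else p') s3 s4 t4,
   s4 0 = (if truthy (B x) then F x else G x), (forall y, K < y -> s4 y = s3 y),
   t4 <= ((ev q (tsize x)) + ev q' (tsize x)) &
   tsize (if truthy (B x) then F x else G x) <= ((ev q (tsize x)) + ev q' (tsize x))].
  case: (truthy _).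
    have [s4 [t4 [e4 v4 f4 b4 c4]]] := hp s3.
    rewrite s3x in v4 b4 c4; exists s4, t4; split=> //.
    - by move=> y hy; rewrite f4 // (ltn_trans KN).
    - exact: leq_trans b4 (leq_addr _ _).
    - exact: leq_trans c4 (leq_addr _ _).
  have [s4 [t4 [e4 v4 f4 b4 c4]]] := hp' s3.
  rewrite s3x in v4 b4 c4; exists s4, t4; split=> //.
  - by move=> y hy; rewrite f4 // (ltn_trans KN').
  - exact: leq_trans b4 (leq_addl _ _).
  - exact: leq_trans c4 (leq_addl _ _).
exists s4; eexists; split.
- apply: exec_seq; first exact: exec_assign.
  apply: exec_seq; first exact: e1.
  apply: exec_seq; first exact: exec_assign.
  apply: exec_seq; first exact: exec_assign.
  by apply: exec_if; rewrite [eval _ _]s3K; exact: e4.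
- exact: v4.
- by move=> y hy; rewrite f4 1?ltnW // f3.
- rewrite /= v1 -/x /upd ltn_eqF // f1 // /s0 /upd eqxx.
  move: b4; rewrite /=; lia.
- move: c4; rewrite /=; lia.
Qed.

(** * Folds over lists *)

Definition lst := fix lst (t : tree) : seq tree := if t is Node a b then a :: lst b else [::].

Definition lsize (t : tree) : nat := size (lst t).

(* [F] sees the whole remaining list and not only its head, so that suffixes can serve as
   indices, a suffix standing for its length. *)
Fixpoint rfold (F : tree -> tree -> tree) (a l : tree) : tree :=
  if l is Node _ b then F l (rfold F a b) else a.

(* The suffixes of [l], shortest first: a left fold over them is a right fold over [l]. *)
Fixpoint revs (l r : tree) : tree :=
  if l is Node _ b then revs b (Node l r) else r.

Fixpoint lfold (F : tree -> tree -> tree) (a l : tree) : tree :=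
  if l is Node h b then lfold F (F h a) b else a.

Lemma lfold_revs F a l r : lfold F a (revs l r) = lfold F (rfold F a l) r.
Proof. by elim: l r => //= h _ b IHb r; rewrite IHb. Qed.

Lemma lsize_tsize l : lsize l <= tsize l.
Proof. by rewrite /lsize; elim: l => //= a _ b IHb; lia. Qed.

Lemma lsize_revs l r : lsize (revs l r) = lsize l + lsize r.
Proof. by elim: l r => //= h _ b IHb r; rewrite IHb /lsize /=; lia. Qed.

Lemma tsize_revs l r : tsize (revs l r) <= tsize r + lsize l * (tsize l).+1.
Proof.
elim: l r => [|h _ b IHb] r /=; first exact: leq_addr.
apply: leq_trans (IHb _) _; rewrite /lsize /=.
have : size (lst b) * (tsize b).+1 <= size (lst b) * (tsize h + tsize b).+2.
  by rewrite leq_mul2l; apply/orP; right; lia.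
lia.
Qed.

Lemma revs_small M l r : tsize l <= M -> all (fun s => tsize s <= M) (lst r) ->
  all (fun s => tsize s <= M) (lst (revs l r)).
Proof.
elim: l r => //= h _ b IHb r hM hr; apply: IHb => /=; first lia.
by rewrite hM.
Qed.

Lemma exec_revs i j s M : i != j -> tsize (revs (s i) (s j)) <= M -> tsize (s i) <= M ->
  exists s' t, [/\ exec (CWhile (EVar i) (CSeq (CAssign j (ECons (EVar i) (EVar j)))
                                       (CAssign i (ETl (EVar i))))) s s' t,
    s' j = revs (s i) (s j), (forall y, y != i -> y != j -> s' y = s y) &
    t <= (lsize (s i) * (M + M + 5)).+1].
Proof.
move=> ij; move E: (s i) => l; elim: l s E => [|h _ b IHb] s E hM hi.
  exists s, 1; split=> //; apply: exec_while_stop; by rewrite /= E.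
pose s1 := upd s j (Node (s i) (s j)).
pose s2 := upd s1 i (tl (s1 i)).
have s1i : s1 i = Node h b by rewrite /s1 /upd (negbTE ij) E.
have s2i : s2 i = b by rewrite /s2 /upd eqxx s1i.
have s2j : s2 j = Node (Node h b) (s j).
  by rewrite /s2 /upd eq_sym (negbTE ij) /s1 /upd eqxx E.
have hb : tsize b <= M by rewrite /= in hi; lia.
(* [revs] only enlarges its accumulator, so the bound [M] on the final value also holds for the
   intermediate ones. *)
have lefold l r : tsize r <= tsize (revs l r).
  by elim: l r => //= ? _ ? IH r; apply: leq_trans (IH _) => /=; lia.
have hj : tsize (Node (Node h b) (s j)) <= M.
  by apply: leq_trans (lefold b _) _; move: hM.
have x1 : exec (CAssign j (ECons (EVar i) (EVar j))) s s1 (tsize (Node (s i) (s j))).+1.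
  exact: exec_assign.
have x2 : exec (CAssign i (ETl (EVar i))) s1 s2 (tsize (tl (s1 i))).+1 by exact: exec_assign.
have [|s' [t [e v f le]]] := IHb s2 s2i _ hb; first by rewrite s2j; move: hM.
exists s'; eexists; split.
- apply: exec_while_step (exec_seq x1 x2) e.
  by rewrite /= E.
- by rewrite v s2j.
- by move=> y yi yj; rewrite f // /s2 /upd (negbTE yi) /s1 /upd (negbTE yj).
- move: le; rewrite s1i E /lsize /=; move: hj => /=; lia.
Qed.

(** The main loop of a fold: [K] holds the environment [x], [K.+2] the accumulator and [K.+3] the
    elements still to be treated. A step enlarges the accumulator by at most [Q], so its size plus
    [Q] times the number of remaining elements stays below [C]. *)
Lemma exec_lfold p N (q : {poly nat}) F K s M C Q x :
  (forall s, exists s' t,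
    [/\ exec p s s' t, s' 0 = F (s 0), (forall y, N < y -> s' y = s y),
        t <= ev q (tsize (s 0)) & tsize (F (s 0)) <= ev q (tsize (s 0))]) ->
  N < K -> s K = x ->
  (forall l acc, tsize l <= M ->
     tsize (F (Node x (Node l acc))) <= tsize acc + Q) ->
  all (fun l => tsize l <= M) (lst (s K.+3)) ->
  tsize (s K.+3) <= C -> M <= C ->
  tsize x <= C -> tsize (s K.+2) + lsize (s K.+3) * Q <= C ->
  exists s' t, [/\ exec (CWhile (EVar K.+3)
      (CSeq (CAssign 0 (ECons (EVar K) (ECons (EHd (EVar K.+3)) (EVar K.+2))))
      (CSeq p (CSeq (CAssign K.+2 (EVar 0)) (CAssign K.+3 (ETl (EVar K.+3))))))) s s' t,
    s' K.+2 = lfold (fun l acc => F (Node x (Node l acc))) (s K.+2) (s K.+3),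
    (forall y, K.+3 < y -> s' y = s y) &
    t <= (lsize (s K.+3) * (5 * C + ev q (C + C + C + 2) + 20)).+1].
Proof.
move=> hp NK; move E: (s K.+3) => l; elim: l s E => [|h _ b IHb] s E sK hF hall hC hM hx hacc.
  exists s, 1; split=> //; apply: exec_while_stop; by rewrite /= E.
pose s1 := upd s 0 (Node (s K) (Node (hd (s K.+3)) (s K.+2))).
have s10 : s1 0 = Node x (Node h (s K.+2)) by rewrite /s1 /upd eqxx sK E.
have [s2 [t2 [e2 v2 f2 b2 c2]]] := hp s1.
rewrite s10 in v2 b2 c2.
pose s3 := upd s2 K.+2 (s2 0).
pose s4 := upd s3 K.+3 (tl (s3 K.+3)).
have f1 y : K <= y -> s2 y = s y.
  move=> hy; rewrite f2 ?(leq_trans NK) // /s1 /upd gtn_eqF //.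
  exact: leq_ltn_trans (leq_trans NK hy).
have ne32 : (K.+3 == K.+2) = false by lia.
have ne23 : (K.+2 == K.+3) = false by lia.
have s33 : s3 K.+3 = Node h b by rewrite /s3 /upd ne32 f1 ?E //; lia.
have s43 : s4 K.+3 = b by rewrite /s4 /upd eqxx s33.
have s42 : s4 K.+2 = F (Node x (Node h (s K.+2))).
  by rewrite /s4 /upd ne23 /s3 /upd eqxx v2.
have s4K : s4 K = x.
  by rewrite /s4 /upd ltn_eqF ?ltnS 1?ltnW // /s3 /upd ltn_eqF // f1.
move: hall => /= /andP[hhM hbM].
have hFb : tsize (F (Node x (Node h (s K.+2)))) <= tsize (s K.+2) + Q by exact: hF.
have hls : lsize (Node h b) = (lsize b).+1 by [].
have hC' : tsize b <= C by rewrite /= in hC; lia.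
have hsC : tsize h <= C by exact: leq_trans hM.
have hacc' : tsize (s4 K.+2) + lsize b * Q <= C.
  rewrite s42; move: hacc; rewrite hls mulSn; lia.
have [s' [t [e v f le]]] := IHb s4 s43 s4K hF hbM hC' hM hx hacc'.
have x1 : exec (CAssign 0 (ECons (EVar K) (ECons (EHd (EVar K.+3)) (EVar K.+2)))) s s1
   (tsize (Node (s K) (Node (hd (s K.+3)) (s K.+2)))).+1 by exact: exec_assign.
have x3 : exec (CAssign K.+2 (EVar 0)) s2 s3 (tsize (s2 0)).+1 by exact: exec_assign.
have x4 : exec (CAssign K.+3 (ETl (EVar K.+3))) s3 s4 (tsize (tl (s3 K.+3))).+1.
  exact: exec_assign.
exists s'; eexists; split.
- apply: exec_while_step (exec_seq x1 (exec_seq e2 (exec_seq x3 x4))) e.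
  by rewrite /= E.
- by rewrite v s42.
- move=> y hy; rewrite f // /s4 /upd gtn_eqF // /s3 /upd gtn_eqF 1?ltnW //.
  by rewrite f1 //; lia.
- have -> : Node (s K) (Node (hd (s K.+3)) (s K.+2)) = Node x (Node h (s K.+2)).
    by rewrite sK E.
  rewrite s33 v2 [tl _]/=.
  have hs : tsize (Node x (Node h (s K.+2))) <= C + C + C + 2 by move: hacc => /=; lia.
  have := ev_mono q hs; move: b2 hs le; rewrite hls (mulSn (lsize b)).
  move: hFb hacc; rewrite hls (mulSn (lsize b)).
  move: (tsize (F _)) (tsize (Node x _)) => a1 a2; lia.
Qed.

(** The bound on [F] is additive in [acc], since a multiplicative one would allow exponential growth
    over the fold. The program lists the suffixes of [L x] in reverse and then runs a left fold over
    them ([lfold_revs]). *)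
Lemma polyt_rfold (F : tree -> tree -> tree -> tree) A L :
  polyt (fun y => F (hd y) (hd (tl y)) (tl (tl y))) -> polyt A -> polyt L ->
  (exists q : {poly nat}, forall x l acc,
     tsize (F x l acc) <= tsize acc + ev q (tsize x + tsize l)) ->
  polyt (fun x => rfold (F x) (A x) (L x)).
Proof.
move=> /polytE [p [N [q hp]]] /polytE [pA [NA [qA hA]]] /polytE [pL [NL [qL hL]]] [Q hQ].
pose K := (maxn NA (maxn N NL)).+1.
have KA : NA < K by rewrite /K; lia.
have KN : N < K by rewrite /K; lia.
have KL : NL < K by rewrite /K; lia.
(* [C n] bounds the saved argument, the list of suffixes (through [tsize_revs]) and the accumulator,
   which starts with size at most [ev qA n] and grows by at most the last summand. *)
pose C n := (n + ev qA n + 1 + ev qL n * (ev qL n).+1 + ev qL n * ev Q (n + ev qL n)).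
exists (CSeq (CAssign K (EVar 0)) (CSeq pL (CSeq (CAssign K.+1 (EVar 0))
  (CSeq (CAssign 0 (EVar K)) (CSeq pA (CSeq (CAssign K.+2 (EVar 0))
  (CSeq (CAssign K.+3 ENil)
  (CSeq (CWhile (EVar K.+1) (CSeq (CAssign K.+3 (ECons (EVar K.+1) (EVar K.+3)))
                                       (CAssign K.+1 (ETl (EVar K.+1)))))
  (CSeq (CWhile (EVar K.+3)
      (CSeq (CAssign 0 (ECons (EVar K) (ECons (EHd (EVar K.+3)) (EVar K.+2))))
      (CSeq p (CSeq (CAssign K.+2 (EVar 0)) (CAssign K.+3 (ETl (EVar K.+3)))))))
      (CAssign 0 (EVar K.+2))))))))))), K.+3,
  (fun n => (50 + n + n + n + 2 * ev qL n + 2 * ev qA n + C n + C n + (C n * (C n + C n + 5)) +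
     C n * (5 * C n + ev q (C n + C n + C n + 2) + 20))).
split; first by rewrite /C; polyb_tac.
move=> s; set x := s 0; set n := tsize x.
pose s0 := upd s K x.
have s0x : s0 0 = x by rewrite /s0 /upd.
have [s1 [t1 [e1 v1 f1 b1 c1]]] := hL s0.
rewrite s0x -/n in v1 b1 c1.
pose s2 := upd s1 K.+1 (s1 0).
pose s3 := upd s2 0 (s2 K).
have s3x : s3 0 = x.
  rewrite /s3 /upd eqxx /s2 /upd ltn_eqF // f1 // /s0 /upd eqxx //.
have [s4 [t4 [e4 v4 f4 b4 c4]]] := hA s3.
rewrite s3x -/n in v4 b4 c4.
pose s5 := upd s4 K.+2 (s4 0).
pose s6 := upd s5 K.+3 Leaf.
have s6K y : y < K.+2 -> s6 y = s4 y.
  by move=> hy; rewrite /s6 /upd ltn_eqF 1?ltnW // /s5 /upd ltn_eqF.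
have s61 : s6 K.+1 = L x.
  by rewrite s6K // f4 1?ltnW // /s3 /upd /= /s2 /upd eqxx.
have s63 : s6 K.+3 = Leaf by rewrite /s6 /upd eqxx.
have s62 : s6 K.+2 = A x by rewrite /s6 /upd ltn_eqF // /s5 /upd eqxx.
have s60 : s6 K = x.
  by rewrite s6K // f4 // /s3 /upd /= /s2 /upd ltn_eqF // f1 // /s0 /upd eqxx.
have hn : tsize x = n by [].
have lL : lsize (L x) <= ev qL n by apply: leq_trans (lsize_tsize _) c1.
have hrev : tsize (revs (L x) Leaf) <= 1 + ev qL n * (ev qL n).+1.
  apply: leq_trans (tsize_revs _ _) _; rewrite leq_add2l; apply: leq_mul => //.
have hrevC : tsize (revs (L x) Leaf) <= C n.
  by apply: leq_trans hrev _; rewrite /C; lia.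
have hLC : tsize (L x) <= C n.
  by apply: leq_trans c1 _; rewrite /C mulnS; move: (_ * ev Q _) (ev qL n * ev qL n) => u v; lia.
have [||| s7 [t7 [e7 v7 f7 b7]]] := @exec_revs K.+1 K.+3 s6 (C n).
- by lia.
- by rewrite s61 s63.
- by rewrite s61.
rewrite s61 s63 in v7 b7.
have s7K : s7 K = x by rewrite f7 ?s60 //; lia.
have s72 : s7 K.+2 = A x by rewrite f7 ?s62 //; lia.
have lC : lsize (L x) <= C n by apply: leq_trans (lsize_tsize _) hLC.
have [|||||| s8 [t8 [e8 v8 f8 b8]]] :=
  @exec_lfold p N q (fun y => F (hd y) (hd (tl y)) (tl (tl y))) K s7
    (ev qL n) (C n) (ev Q (n + ev qL n)) x hp KN s7K.
- move=> l acc hl /=; apply: leq_trans (hQ _ _ _) _; rewrite leq_add2l.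
  by apply: ev_mono; rewrite leq_add2l.
- by rewrite v7; apply: revs_small.
- by rewrite v7.
- by rewrite /C mulnS; move: (_ * ev Q _) (ev qL n * ev qL n) => u v; lia.
- by rewrite /C; move: (_ * ev Q _) (ev qL n * _) => u v; rewrite /n; lia.
- rewrite s72 v7 lsize_revs addn0 /C.
  have : lsize (L x) * ev Q (n + ev qL n) <= ev qL n * ev Q (n + ev qL n) by apply: leq_mul.
  by move: (ev qL n * ev Q _) (ev qL n * _.+1) => u v; lia.
rewrite s72 v7 lfold_revs /= in v8.
rewrite v7 lsize_revs addn0 in b8.
have szR : tsize (rfold (F x) (A x) (L x)) <= C n.
  have : forall l, tsize l <= ev qL n -> tsize (rfold (F x) (A x) l) <=
       tsize (A x) + lsize l * ev Q (n + ev qL n).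
    elim=> [|h _ b IHb] hl /=; first exact: leq_addr.
    apply: leq_trans (hQ _ _ _) _.
    have := @ev_mono Q (tsize x + tsize (Node h b)) _ (leq_add (leqnn n) hl).
    have hb : tsize b <= ev qL n by move: hl => /=; lia.
    have := IHb hb; rewrite /lsize /= mulSn; lia.
  move/(_ _ c1)/leq_trans; apply; rewrite /C.
  have : lsize (L x) * ev Q (n + ev qL n) <= ev qL n * ev Q (n + ev qL n) by apply: leq_mul.
  by move: (ev qL n * ev Q _) (ev qL n * _.+1) => u v; lia.
have s2K : s2 K = x by rewrite /s2 /upd ltn_eqF // f1 // /s0 /upd eqxx.
have x0 : exec (CAssign K (EVar 0)) s s0 n.+1 by exact: exec_assign.
have x2 : exec (CAssign K.+1 (EVar 0)) s1 s2 (tsize (L x)).+1.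
  by rewrite -v1; exact: exec_assign.
have x3 : exec (CAssign 0 (EVar K)) s2 s3 n.+1.
  by rewrite /n -s2K; exact: exec_assign.
have x5 : exec (CAssign K.+2 (EVar 0)) s4 s5 (tsize (A x)).+1.
  by rewrite -v4; exact: exec_assign.
have x6 : exec (CAssign K.+3 ENil) s5 s6 2 by exact: exec_assign.
pose s9 := upd s8 0 (s8 K.+2).
have x9 : exec (CAssign 0 (EVar K.+2)) s8 s9 (tsize (rfold (F x) (A x) (L x))).+1.
  by rewrite -v8; exact: exec_assign.
exists s9; eexists; split.
- exact: exec_seq x0 (exec_seq e1 (exec_seq x2 (exec_seq x3 (exec_seq e4
    (exec_seq x5 (exec_seq x6 (exec_seq e7 (exec_seq e8 x9)))))))).
- by rewrite /s9 /upd eqxx v8.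
- move=> y hy; rewrite /s9 /upd gtn_eqF ?(leq_ltn_trans _ hy) //.
  rewrite f8 // f7; [|lia|lia].
  rewrite /s6 /upd gtn_eqF // /s5 /upd gtn_eqF 1?ltnW // f4; last lia.
  rewrite /s3 /upd gtn_eqF; last lia.
  rewrite /s2 /upd gtn_eqF; last lia.
  rewrite f1; last lia.
  by rewrite /s0 /upd gtn_eqF //; lia.
- rewrite -/n.
  have h1 : lsize (L x) * (C n + C n + 5) <= C n * (C n + C n + 5) by apply: leq_mul.
  have h2 : lsize (L x) * (5 * C n + ev q (C n + C n + C n + 2) + 20) <=
     C n * (5 * C n + ev q (C n + C n + C n + 2) + 20) by apply: leq_mul.
  have h3 : t7 <= _ := leq_trans b7 (h1 : _.+1 <= _.+1).
  have h4 : t8 <= _ := leq_trans b8 (h2 : _.+1 <= _.+1).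
  move: h3 h4 c1 c4 b1 b4 szR; clear.
  move: (C n) (C n * _) (C n * _) => Cn z1 z2.
  move: (tsize (rfold _ _ _)) (tsize (L x)) (tsize (A x)) => a1 a2 a3; lia.
- rewrite -/n; apply: leq_trans szR _; lia.
Qed.

(** * Running a given program inside a larger one *)

Fixpoint ebound (e : expr) : nat :=
  match e with
  | EVar x => x.+1
  | ENil => 0
  | ECons a b => maxn (ebound a) (ebound b)
  | EHd a => ebound a
  | ETl a => ebound a
  end.

Fixpoint cbound (p : cmd) : nat :=
  match p with
  | CSkip => 0
  | CAssign x e => maxn x.+1 (ebound e)
  | CSeq p q => maxn (cbound p) (cbound q)
  | CIf e p q => maxn (ebound e) (maxn (cbound p) (cbound q))
  | CWhile e p => maxn (ebound e) (cbound p)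
  end.

Lemma eval_agree N s s' e : ebound e <= N -> (forall x, x < N -> s' x = s x) ->
  eval s' e = eval s e.
Proof.
move=> + h; elim: e => [x /h||a IHa b IHb|a IHa|a IHa] //=.
- by rewrite geq_max => /andP[/IHa -> /IHb ->].
- by move=> /IHa ->.
- by move=> /IHa ->.
Qed.

(** A program touches no variable from [cbound p] on, so its run can be replayed in a store that
    holds saved data there. *)
Lemma exec_agree N p s s' t : exec p s s' t -> cbound p <= N ->
  forall r, (forall x, x < N -> r x = s x) ->
  exists r', [/\ exec p r r' t, (forall x, x < N -> r' x = s' x)
    & (forall x, N <= x -> r' x = r x)].
Proof.
elim=> {p s s' t} /=.
- by move=> s _ r hr; exists r; split=> //; exact: exec_skip.
- move=> s x e; rewrite geq_max => /andP[hx he] r hr.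
  have ee := eval_agree he hr.
  exists (upd r x (eval r e)); split.
  + rewrite -ee; exact: exec_assign.
  + by move=> y hy; rewrite /upd ee hr.
  + by move=> y hy; rewrite /upd gtn_eqF // (leq_trans hx).
- move=> p q s s1 s2 t1 t2 _ IH1 _ IH2; rewrite geq_max => /andP[h1 h2] r hr.
  have [r1 [e1 a1 b1]] := IH1 h1 _ hr; have [r2 [e2 a2 b2]] := IH2 h2 _ a1.
  exists r2; split=> //; first exact: exec_seq e1 e2.
  by move=> x hx; rewrite b2 ?b1.
- move=> e p q s s' t _ IH; rewrite !geq_max => /and3P[he hp hq] r hr.
  have hc : cbound (if truthy (eval s e) then p else q) <= N by case: ifP.
  have [r' [e1 a1 b1]] := IH hc _ hr; exists r'; split=> //.
  by apply: exec_if; rewrite (eval_agree he hr).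
- move=> e p s hs; rewrite geq_max => /andP[he hp] r hr.
  exists r; split=> //; apply: exec_while_stop; by rewrite (eval_agree he hr).
- move=> e p s s1 s2 t1 t2 hs _ IH1 _ IH2 hep r hr.
  have /andP[he hp] : (ebound e <= N) && (cbound p <= N) by rewrite -geq_max.
  have [r1 [e1 a1 b1]] := IH1 hp _ hr; have [r2 [e2 a2 b2]] := IH2 hep _ a1.
  exists r2; split=> //; last by move=> x hx; rewrite b2 ?b1.
  by apply: exec_while_step e1 e2; rewrite (eval_agree he hr).
Qed.

(** An assignment is charged the size of its value, so the time bounds every newly written value.
    This bounds the output of a program of which only the running time is known. *)
Lemma exec_size p s s' t : exec p s s' t -> forall x, tsize (s' x) <= maxn (tsize (s x)) t.
Proof.
elim=> {p s s' t} /=.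
- by move=> s x; rewrite leq_maxl.
- move=> s x e y; rewrite /upd; case: ifP => _; last exact: leq_maxl.
  by rewrite leq_max leqnSn orbT.
- move=> p q s s1 s2 t1 t2 _ IH1 _ IH2 x; have := IH1 x; have := IH2 x; lia.
- move=> e p q s s' t _ IH x; have := IH x; lia.
- by move=> e p s _ x; rewrite leq_maxl.
- move=> e p s s1 s2 t1 t2 _ _ IH1 _ IH2 x; have := IH1 x; have := IH2 x; lia.
Qed.

(** The given program expects [Leaf] in all variables except 0, whereas the computation of its input
    may leave other values behind. *)
Fixpoint clear_vars (n : nat) : cmd :=
  if n is m.+1 then CSeq (CAssign n ENil) (clear_vars m) else CSkip.

Lemma exec_clear_vars n s : exists s', [/\ exec (clear_vars n) s s' (n * 3 + 1),
  (forall x, 0 < x <= n -> s' x = Leaf), s' 0 = s 0 & forall x, n < x -> s' x = s x].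
Proof.
elim: n s => [|n IHn] s /=.
  by exists s; split=> //; [exact: exec_skip | case].
have [s' [e h1 h2 h3]] := IHn (upd s n.+1 Leaf); exists s'; split.
- by have := exec_seq (exec_assign s n.+1 ENil) e; rewrite mulSn.
- move=> x /andP[x0]; rewrite leq_eqVlt => /orP[/eqP->|hx]; last by rewrite h1 ?x0.
  by rewrite h3 // /upd eqxx.
- by rewrite h2.
- by move=> x hx; rewrite h3 1?ltnW // /upd gtn_eqF.
Qed.

(** [B] receives the original instance along with the output of [p], so [i] is kept in a variable
    above those of all three programs. *)
Lemma reduction_runs (p : cmd) (time : {poly nat}) A B : polyt A -> polyt B ->
  exists (p' : cmd) (time' : {poly nat}), forall i out t,
    runs p (A i) out t -> t <= ev time (tsize (A i)) ->
  exists2 t', runs p' i (B (Node i out)) t' & t' <= ev time' (tsize i).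
Proof.
move=> /polytE [pA [NA [qA hA]]] /polytE [pB [NB [qB hB]]].
pose K := (maxn NA (maxn NB (cbound p))).+1.
have KA : NA < K by rewrite /K; lia.
have KB : NB < K by rewrite /K; lia.
have Kp : cbound p <= K by rewrite /K; lia.
pose g n := 20 + n + n + (K * 3 + ev qA n + ev time (ev qA n)) +
  (n + ev qA n + ev time (ev qA n)) + ev qB (n + ev qA n + ev time (ev qA n) + 1).
have [q' hq'] : polyb g by rewrite /g; polyb_tac.
exists (CSeq (CAssign K (EVar 0)) (CSeq pA (CSeq (clear_vars K.-1) (CSeq p
   (CSeq (CAssign 0 (ECons (EVar K) (EVar 0))) pB))))), q' => i out t.
set n := tsize i; move=> [s' ep s'0] ht.
pose s0 := upd (fun=> Leaf) 0 i.
pose s1 := upd s0 K i.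
have x1 : exec (CAssign K (EVar 0)) s0 s1 n.+1.
  have -> : n.+1 = (tsize (eval s0 (EVar 0))).+1 by [].
  have -> : s1 = upd s0 K (eval s0 (EVar 0)) by [].
  exact: exec_assign.
have [s2 [t2 [e2 v2 f2 b2 c2]]] := hA s1.
have s10 : s1 0 = i by rewrite /s1 /upd.
rewrite s10 -/n in v2 b2 c2.
have [s3 [e3 h31 h32 h33]] := exec_clear_vars K.-1 s2.
have s3K : s3 K = i by rewrite h33 // f2 // /s1 /upd eqxx.
have [|s4 [e4 a4 b4]] := exec_agree ep Kp (r := s3).
  case=> [|x] hx; rewrite /upd /=; first by rewrite h32 v2.
  by rewrite h31 //= -ltnS /K.
pose s5 := upd s4 0 (Node (s4 K) (s4 0)).
have s4K : s4 K = i by rewrite b4.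
have s40 : s4 0 = out by rewrite a4.
have x5 : exec (CAssign 0 (ECons (EVar K) (EVar 0))) s4 s5 (tsize (Node i out)).+1.
  by rewrite -s4K -s40; exact: exec_assign.
have [s6 [t6 [e6 v6 f6 b6 c6]]] := hB s5.
have s50 : s5 0 = Node i out by rewrite /s5 /upd eqxx s4K s40.
rewrite s50 in v6 b6 c6.
have szout : tsize out <= ev qA n + ev time (ev qA n).
  have := exec_size e4 0; rewrite s40 h32 v2.
  have := ev_mono time c2; lia.
eexists.
  exists s6; last exact: v6.
  exact: exec_seq x1 (exec_seq e2 (exec_seq e3 (exec_seq e4 (exec_seq x5 e6)))).
apply: leq_trans (hq' n); rewrite /g.
have h1 : ev qB (tsize (Node i out)) <= ev qB (n + ev qA n + ev time (ev qA n) + 1).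
  by apply: ev_mono => /=; rewrite -/n; lia.
have h2 := ev_mono time c2.
have h3 : tsize (Node i out) = (n + tsize out).+1 by [].
rewrite h3 in b6 h1 *.
have : K.-1 * 3 + 1 <= K * 3 + 1 by rewrite leq_add2r leq_mul2r leq_pred orbT.
move: ht h1 h2 b6 b2 szout; clear.
move: (K.-1 * 3) (K * 3) => k1 k2; lia.
Qed.

(** * List combinators *)

Lemma polyt_rfold1 (F : tree -> tree -> tree -> tree) A L (c : nat) :
  polyt (fun y => F (hd y) (hd (tl y)) (tl (tl y))) -> polyt A -> polyt L ->
  (forall x l acc, tsize (F x l acc) <= tsize acc + c) ->
  polyt (fun x => rfold (F x) (A x) (L x)).
Proof.
move=> hF hA hL hc; apply: polyt_rfold => //.
have [q hq] := polyb_const c.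
by exists q => x l acc; apply: leq_trans (hc _ _ _) _; rewrite leq_add2l.
Qed.

(** Only the length of [a] matters, as a unary number. [tdrop] serves as truncated subtraction and,
    through [truthy], as a strict comparison of lengths. *)
Definition tdrop (a b : tree) := rfold (fun _ acc => tl acc) b a.
Definition tcat (a b : tree) := rfold (fun l acc => Node (hd l) acc) b a.
(** Here and below [G] is given each nonempty suffix of [l]: its head is the element, and its length
    identifies the position. *)
Definition tmaps (G : tree -> tree) (l : tree) := rfold (fun s acc => Node (G s) acc) Leaf l.
Definition tflat (G : tree -> tree) (l : tree) := rfold (fun s acc => tcat (G s) acc) Leaf l.
Definition tbool (b : bool) : tree := if b then Node Leaf Leaf else Leaf.
Definition thas (G : tree -> tree) (l : tree) :=
  rfold (fun s acc => if truthy (G s) then tbool true else acc) Leaf l.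
Definition tall (G : tree -> tree) (l : tree) :=
  rfold (fun s acc => if truthy (G s) then acc else Leaf) (tbool true) l.

Lemma polyt_tbool b : polyt (fun=> tbool b).
Proof. case: b; last exact: polyt_leaf; apply: polyt_node; exact: polyt_leaf. Qed.

Lemma tsize_tdrop a b : tsize (tdrop a b) <= tsize b.
Proof.
by elim: a => //= h _ a; apply: leq_trans; exact: tsize_tl.
Qed.

Lemma polyt_tdrop A B : polyt A -> polyt B -> polyt (fun x => tdrop (A x) (B x)).
Proof.
move=> hA hB; apply: (@polyt_rfold1 (fun _ _ acc => tl acc) B A 0) => //.
  by apply: polyt_tl; apply: polyt_tl; apply: polyt_tl; exact: polyt_id.
by move=> x l acc; rewrite addn0 tsize_tl.
Qed.

Lemma polyt_tcat A B : polyt A -> polyt B -> polyt (fun x => tcat (A x) (B x)).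
Proof.
move=> hA hB; apply: (@polyt_rfold (fun _ l acc => Node (hd l) acc) B A) => //.
  apply: polyt_node; first by do 2 apply: polyt_hd; apply: polyt_tl; exact: polyt_id.
  by do 2 apply: polyt_tl; exact: polyt_id.
have [q hq] : polyb (fun n => n.+1) by polyb_tac.
exists q => x l acc /=; have := hq (tsize x + tsize l); have := tsize_hd l; lia.
Qed.

Lemma tsize_tcat a b : tsize (tcat a b) < tsize a + tsize b.
Proof.
by elim: a => //= h _ l; rewrite /tcat /= -/(tcat l b); lia.
Qed.

(** The first argument of [G] is an environment with the values of the outer variables, which is
    what allows loops to be nested. *)
Lemma polyt_tmaps (G : tree -> tree -> tree) L :
  polyt (fun y => G (hd y) (tl y)) -> polyt L -> polyt (fun x => tmaps (G x) (L x)).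
Proof.
move=> hG hL; apply: (@polyt_rfold (fun x s acc => Node (G x s) acc)) => //.
- apply: polyt_node; last by do 2 apply: polyt_tl; exact: polyt_id.
  apply: (polyt_ext (F := fun y => (fun z => G (hd z) (tl z)) (Node (hd y) (hd (tl y))))) => //.
  apply: polyt_comp hG _; apply: polyt_node; first by apply: polyt_hd; exact: polyt_id.
  by apply: polyt_hd; apply: polyt_tl; exact: polyt_id.
- exact: polyt_leaf.
have [q hq] := polyt_size hG.
have [q' hq'] : polyb (fun n => (ev q n.+1).+1) by polyb_tac.
exists q' => x l acc /=; have := hq' (tsize x + tsize l); have := hq (Node x l); simpl; lia.
Qed.

Lemma polyt_tflat (G : tree -> tree -> tree) L :
  polyt (fun y => G (hd y) (tl y)) -> polyt L -> polyt (fun x => tflat (G x) (L x)).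
Proof.
move=> hG hL; apply: (@polyt_rfold (fun x s acc => tcat (G x s) acc)) => //.
- apply: polyt_tcat; last by do 2 apply: polyt_tl; exact: polyt_id.
  apply: (polyt_ext (F := fun y => (fun z => G (hd z) (tl z)) (Node (hd y) (hd (tl y))))) => //.
  apply: polyt_comp hG _; apply: polyt_node; first by apply: polyt_hd; exact: polyt_id.
  by apply: polyt_hd; apply: polyt_tl; exact: polyt_id.
- exact: polyt_leaf.
have [q hq] := polyt_size hG.
have [q' hq'] : polyb (fun n => (ev q n.+1).+1) by polyb_tac.
exists q' => x l acc; have := hq' (tsize x + tsize l); have := hq (Node x l).
have := tsize_tcat (G x l) acc; simpl; lia.
Qed.

Lemma polyt_thas (G : tree -> tree -> tree) L :
  polyt (fun y => G (hd y) (tl y)) -> polyt L -> polyt (fun x => thas (G x) (L x)).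
Proof.
move=> hG hL.
apply: (@polyt_rfold1 (fun x s acc => if truthy (G x s) then tbool true else acc) _ _ 3) => //.
- apply: polyt_if; last 2 first.
  + exact: polyt_tbool.
  + by do 2 apply: polyt_tl; exact: polyt_id.
  apply: (polyt_ext (F := fun y => (fun z => G (hd z) (tl z)) (Node (hd y) (hd (tl y))))) => //.
  apply: polyt_comp hG _; apply: polyt_node; first by apply: polyt_hd; exact: polyt_id.
  by apply: polyt_hd; apply: polyt_tl; exact: polyt_id.
- exact: polyt_leaf.
by move=> x l acc; case: ifP => _ /=; lia.
Qed.

Lemma polyt_tall (G : tree -> tree -> tree) L :
  polyt (fun y => G (hd y) (tl y)) -> polyt L -> polyt (fun x => tall (G x) (L x)).
Proof.
move=> hG hL.
apply: (@polyt_rfold1 (fun x s acc => if truthy (G x s) then acc else Leaf) _ _ 3) => //.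
- apply: polyt_if; last 2 first.
  + by do 2 apply: polyt_tl; exact: polyt_id.
  + exact: polyt_leaf.
  apply: (polyt_ext (F := fun y => (fun z => G (hd z) (tl z)) (Node (hd y) (hd (tl y))))) => //.
  apply: polyt_comp hG _; apply: polyt_node; first by apply: polyt_hd; exact: polyt_id.
  by apply: polyt_hd; apply: polyt_tl; exact: polyt_id.
- exact: polyt_tbool.
by move=> x l acc; case: ifP => _ /=; lia.
Qed.

Local Open Scope ring_scope.

(** * Stable graphs *)

Lemma ler_sum_sub (R : numDomainType) (I : finType) (P Q : pred I) (F : I -> R) :
  subpred P Q -> (forall i, Q i -> 0 <= F i) -> \sum_(i | P i) F i <= \sum_(i | Q i) F i.
Proof.
move=> PQ F0; rewrite [leRHS](bigID P) /=.
have -> : \sum_(i | Q i && P i) F i = \sum_(i | P i) F i.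
  by apply: eq_bigl => i; case: (boolP (P i)) => [/PQ->|]; rewrite ?andbF.
by rewrite lerDl; apply: sumr_ge0 => i /andP[/F0].
Qed.

Lemma edgesP (G : sgraph) (e : {set vertex G}) :
  reflect (exists u v : vertex G, adj u v /\ e = [set u; v]) (e \in edges G).
Proof.
rewrite inE; apply: (iffP existsP) => [[u /existsP[v /andP[uv /eqP->]]]|[u [v [uv ->]]]].
  by exists u, v.
by exists u; apply/existsP; exists v; rewrite uv eqxx.
Qed.

Lemma adj_neq (G : sgraph) (u v : vertex G) : adj u v -> u != v.
Proof. by apply: contraTneq => ->; rewrite adj_irr. Qed.

Lemma set2_edges (G : sgraph) (u v : vertex G) : ([set u; v] \in edges G) = adj u v.
Proof.
apply/edgesP/idP => [[a [b [ab E]]]|uv]; last by exists u, v.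
have ab' := adj_neq ab.
have : a \in [set u; v] by rewrite E set21.
have : b \in [set u; v] by rewrite E set22.
have : u \in [set a; b] by rewrite -E set21.
have : v \in [set a; b] by rewrite -E set22.
rewrite !inE => /orP[]/eqP-> /orP[]/eqP-> // ; rewrite ?orbb.
- by move=> /eqP ba; rewrite ba eqxx in ab'.
- by rewrite adj_sym.
- by move=> _ /eqP ba; rewrite ba eqxx in ab'.
Qed.

Lemma sum_set2 (R : nmodType) (T : finType) (u v : T) (F : T -> R) : u != v ->
  \sum_(i in [set u; v]) F i = F u + F v.
Proof. by move=> uv; rewrite big_setU1 ?big_set1 ?inE. Qed.

Lemma nu_ge (R : realType) (G : sgraph) (w : weighting R G) (M : {set {set vertex G}}) :
  matching M -> \sum_(e in M) w e <= nu w.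
Proof. by move=> hM; rewrite /nu; apply: le_bigmax_cond. Qed.

Lemma nu_attained (R : realType) (G : sgraph) (w : weighting R G) :
  exists2 M : {set {set vertex G}}, matching M & \sum_(e in M) w e = nu w.
Proof.
rewrite /nu; elim/big_ind: _ => [|a b [M hM <-] [N hN <-]|M hM]; last by exists M.
  exists set0; last by rewrite big_set0.
  by rewrite /matching sub0set; apply/trivIsetP => A B; rewrite inE.
by case: (leP (\sum_(e in M) w e) (\sum_(e in N) w e)) => _; [exists N | exists M].
Qed.

Lemma frac_cover_matching (R : realType) (G : sgraph) (w : weighting R G) y
    (M : {set {set vertex G}}) :
  frac_cover w y -> matching M -> \sum_(e in M) w e <= \sum_v y v.
Proof.
move=> [y0 yw] /andP[/subsetP ME tM].
apply: (@le_trans _ _ (\sum_(v in cover M) y v)); last first.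
  by apply: ler_sum_sub.
rewrite big_trivIset //; apply: ler_sum => e /ME /edgesP[u [v [uv ->]]].
by rewrite sum_set2 ?adj_neq // yw.
Qed.

(** By weak duality ([frac_cover_matching]), a matching and a fractional cover of equal weight
    certify each other's optimality. *)
Lemma stableP (R : realType) (G : sgraph) (w : weighting R G) :
  stable w <-> exists y (M : {set {set vertex G}}),
    [/\ frac_cover w y, matching M & \sum_v y v = \sum_(e in M) w e].
Proof.
split=> [[[y hy yE] _]|[y [M [hy hM E]]]].
  by have [M hM ME] := nu_attained w; exists y, M; rewrite ME yE.
have nuE : nu w = \sum_v y v.
  apply/le_anti; rewrite E nu_ge // andbT -E.
  by have [N hN <-] := nu_attained w; apply: frac_cover_matching.
split; first by exists y.
move=> y' hy'; have [N hN <-] := nu_attained w; exact: frac_cover_matching.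
Qed.

(** The slacks of the matched edges and the values of [y] on the exposed vertices are nonnegative
    and sum to zero. *)
Lemma complementary_slackness (R : realType) (G : sgraph) (w : weighting R G) y
    (M : {set {set vertex G}}) :
  frac_cover w y -> matching M -> \sum_v y v = \sum_(e in M) w e ->
  (forall e, e \in M -> \sum_(v in e) y v = w e) /\ (forall v, v \notin cover M -> y v = 0).
Proof.
move=> [y0 yw] /andP[/subsetP ME tM] E.
have le_e e : e \in M -> w e <= \sum_(v in e) y v.
  by move=> /ME /edgesP[u [v [uv ->]]]; rewrite sum_set2 ?adj_neq // yw.
move: E; rewrite (bigID (fun v => v \in cover M)) /= big_trivIset //.
move=> /eqP; rewrite -subr_eq0 addrAC -sumrB paddr_eq0; last 2 first.
- by apply: sumr_ge0 => e /le_e; rewrite subr_ge0.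
- by apply: sumr_ge0.
move=> /andP[/eqP h1 /eqP h2]; split.
  move=> e eM; apply/eqP; rewrite -subr_eq0; apply/eqP.
  by apply: (psumr_eq0P _ h1) => // i /le_e; rewrite subr_ge0.
by move=> v hv; apply: (psumr_eq0P _ h2).
Qed.

(** Fixed points of [mate] are the exposed vertices. Raising each matched edge to the weight
    [y u + y v] makes the matching as heavy as [y], which vanishes elsewhere; the increase
    [y u + y v - 1] is split evenly between the two ends. *)
Lemma additive_stabilizer_of_mate (R : realType) (G : sgraph) (y : vertex G -> R)
    (mate : vertex G -> vertex G) :
  involutive mate -> (forall v, mate v != v -> adj v (mate v)) ->
  (forall v, 0 <= y v) -> (forall u v, adj u v -> 1 <= y u + y v) ->
  (forall v, mate v = v -> y v = 0) ->
  exists2 c : weighting R G, frac_additive_stabilizer c &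
    \sum_(e in edges G) c e = \sum_(v | mate v != v) (y v - 2^-1).
Proof.
move=> mK madj y0 yadj yfix.
pose M : {set {set vertex G}} := [set [set v; mate v] | v in [set v | mate v != v]].
have inM (v : vertex G) e : e \in M -> v \in e -> e = [set v; mate v] /\ mate v != v.
  move=> /imsetP[u]; rewrite inE => hu -> /set2P[]->; first by [].
  by rewrite mK setUC; split=> //; rewrite eq_sym.
have ME : M \subset edges G.
  apply/subsetP => e /imsetP[u]; rewrite inE => /madj uv ->; by rewrite set2_edges.
have tM : trivIset M.
  apply/trivIsetP => A B AM BM AB; apply/pred0P => v /=.
  apply/negP => /andP[vA vB]; move/eqP: AB; apply.
  by have [-> _] := inM v A AM vA; have [-> _] := inM v B BM vB.
have covM v : (v \in cover M) = (mate v != v).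
  apply/bigcupP/idP => [[e eM ve]|hv]; first by have [] := inM v e eM ve.
  by exists [set v; mate v]; [apply/imsetP; exists v; rewrite ?inE | rewrite set21].
pose c e := if e \in M then \sum_(v in e) y v - 1 else 0.
have ce0 e : e \in edges G -> 0 <= c e.
  move=> /edgesP[u [v [uv ->]]]; rewrite /c; case: ifP => // _.
  by rewrite sum_set2 ?adj_neq // subr_ge0 yadj.
have sumM F : \sum_(e in M) \sum_(v in e) F v = \sum_(v | mate v != v) F v :> R.
  by rewrite -big_trivIset //; apply: eq_bigl => v; rewrite covM.
exists c.
  split=> //; apply/stableP; exists y, M; split; last 2 first.
  - by rewrite /matching ME.
  - transitivity (\sum_(e in M) \sum_(v in e) y v).
      rewrite sumM (bigID (fun v => mate v != v)) /= [X in _ + X]big1 ?addr0 //.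
      by move=> v /negPn /eqP /yfix.
    by apply: eq_bigr => e eM; rewrite /c eM subrKC.
  split=> // u v uv; rewrite /c; case: ifP => _; last by rewrite addr0 yadj.
  by rewrite sum_set2 ?adj_neq // subrKC.
rewrite (bigID (fun e => e \in M)) /= [X in _ + X]big1 ?addr0; last first.
  by move=> e /andP[_ /negbTE]; rewrite /c => ->.
rewrite -sumM; apply: eq_big => [e|e /andP[_ eM]].
  by apply/andP/idP => [[]//|eM]; split=> //; apply: (subsetP ME).
rewrite /c eM; have /(subsetP ME)/edgesP[u [v [uv ->]]] := eM.
by rewrite !sum_set2 ?adj_neq //; lra.
Qed.

(** * The gadget graph *)

(* [LZ z] is an absorber, [LX p q] the vertex of the edge [{p, q}] of [H], and [LQ u i j c] a
   vertex of the [i]-th clique of [u]; the intended matching pairs [LQ u i j false] with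
   [LQ u i j true]. *)
Inductive label :=
| LZ of nat
| LX of nat & nat
| LQ of nat & nat & nat & bool.

Definition label_code (a : label) : nat * (nat * (nat * (nat * bool))) :=
  match a with
  | LZ z => (0, (z, (0, (0, false))))
  | LX p q => (1, (p, (q, (0, false))))
  | LQ u i j c => (2, (u, (i, (j, c))))
  end%N.

Definition label_decode (x : nat * (nat * (nat * (nat * bool)))) : label :=
  match x with
  | (0, (z, _)) => LZ z
  | (1, (p, (q, _))) => LX p q
  | (_, (u, (i, (j, c)))) => LQ u i j c
  end%N.

Lemma label_codeK : cancel label_code label_decode.
Proof. by case. Qed.

HB.instance Definition _ := Equality.copy label (can_type label_codeK).

(** In the graph built below the indices [j] are lengths of nonempty suffixes, so the index 1 occurs
    in every clique and can mark the port. *)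
Definition is_port (j : nat) (c : bool) := (j == 1%N) && ~~ c.

Definition lrel (a b : label) : bool :=
  match a, b with
  | LZ _, LX _ _ | LX _ _, LZ _ => true
  | LX p q, LQ u _ j c | LQ u _ j c, LX p q => is_port j c && ((u == p) || (u == q))
  | LQ u i j c, LQ u' i' j' c' => [&& u == u', i == i' & (j, c) != (j', c')]
  | _, _ => false
  end.

Definition q_index (us ts js : seq nat) :=
  [seq (u, x) | u <- us,
     x <- [seq (i, x) | i <- ts, x <- [seq (j, c) | j <- js, c <- [:: false; true]]]].

Definition LQ_of (x : nat * (nat * (nat * bool))) := LQ x.1 x.2.1 x.2.2.1 x.2.2.2.

Definition labels (zs : seq nat) (es : seq (nat * nat)) (us ts js : seq nat) : seq label :=
  [seq LZ z | z <- zs] ++ [seq LX e.1 e.2 | e <- es] ++ [seq LQ_of x | x <- q_index us ts js].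

(* The lists enumerate the absorbers, the edges and the vertices of [H], the cliques of each
   vertex and the pairs of matched vertices of each clique. *)
Record gadget := Gadget {
  zs : seq nat;
  es : seq (nat * nat);
  us : seq nat;
  ts : seq nat;
  js : seq nat;
  zs_uniq : uniq zs;
  es_uniq : uniq es;
  us_uniq : uniq us;
  ts_uniq : uniq ts;
  js_uniq : uniq js;
  one_js : 1%N \in js;
  es_us : forall e, e \in es -> (e.1 \in us) && (e.2 \in us);
  gg : sgraph;
  lab : vertex gg -> label;
  labE : [seq lab v | v <- enum (vertex gg)] = labels zs es us ts js;
  adjE : forall u v : vertex gg, adj u v = lrel (lab u) (lab v)
}.

Definition gadget_labels (d : gadget) := labels (zs d) (es d) (us d) (ts d) (js d).

Lemma mem_q_index us ts js x : (x \in q_index us ts js) =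
  [&& x.1 \in us, x.2.1 \in ts & x.2.2.1 \in js].
Proof.
case: x => [u [i [j c]]] /=; apply/idP/and3P => [|[hu hi hj]].
  case/allpairsPdep=> [u' [x [hu /allpairsPdep[i' [y [hi]]]]]].
  by case/allpairsPdep=> [j' [c' [hj _ ->]]] -> [-> -> -> _].
rewrite /q_index; apply/allpairsPdep; exists u, (i, (j, c)); split=> //.
apply/allpairsPdep; exists i, (j, c); split=> //.
by apply/allpairsPdep; exists j, c; split=> //; case: c.
Qed.

Lemma q_index_uniq us ts js : uniq us -> uniq ts -> uniq js -> uniq (q_index us ts js).
Proof.
move=> hu hi hj; apply: allpairs_uniq => //; last by move=> [? ?] [? ?].
apply: allpairs_uniq => //; last by move=> [? ?] [? ?].
by apply: allpairs_uniq => //; move=> [? ?] [? ?].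
Qed.

Lemma mem_labels zs es us ts js a : (a \in labels zs es us ts js) =
  match a with
  | LZ z => z \in zs
  | LX p q => (p, q) \in es
  | LQ u i j c => [&& u \in us, i \in ts & j \in js]
  end.
Proof.
rewrite !mem_cat; case: a => [z|p q|u i j c].
- rewrite mem_map; last by move=> ? ? [].
  rewrite [X in _ || X](_ : _ = false) ?orbF //; apply/negbTE/norP.
  by split; apply/mapP => -[? _].
- rewrite [X in X || _](_ : _ = false) /=; last by apply/negbTE/mapP => -[? _].
  rewrite [X in _ || X](_ : _ = false) ?orbF; last by apply/negbTE/mapP => -[? _].
  apply/mapP/idP => [[[p' q'] h [-> ->]] //|h]; by exists (p, q).
- rewrite [X in X || _](_ : _ = false) /=; last by apply/negbTE/mapP => -[? _].
  rewrite [X in X || _](_ : _ = false) /=; last by apply/negbTE/mapP => -[? _].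
  rewrite (_ : LQ u i j c = LQ_of (u, (i, (j, c)))) // mem_map ?mem_q_index //.
  by move=> [? [? [? ?]]] [? [? [? ?]]] [-> -> -> ->].
Qed.

Lemma labels_uniq zs es us ts js : uniq zs -> uniq es -> uniq us -> uniq ts -> uniq js ->
  uniq (labels zs es us ts js).
Proof.
move=> hz he hu hi hj.
rewrite /labels !cat_uniq !map_inj_uniq ?hz ?he ?q_index_uniq //=; last 3 first.
- by move=> [? [? [? ?]]] [? [? [? ?]]] [-> -> -> ->].
- by move=> [? ?] [? ?] [-> ->].
- by move=> ? ? [].
rewrite andbT; apply/andP; split; apply/hasPn => a.
  by rewrite mem_cat => /orP[] /mapP[? _ ->]; apply/mapP => -[? _].
by move=> /mapP[? _ ->]; apply/mapP => -[? _].
Qed.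

Lemma gadget_labels_uniq d : uniq (gadget_labels d).
Proof. by apply: labels_uniq; case: d. Qed.

Lemma lab_in d (v : vertex (gg d)) : lab v \in gadget_labels d.
Proof. by rewrite /gadget_labels -labE; apply: map_f; rewrite mem_enum. Qed.

Lemma lab_inj d : injective (@lab d).
Proof.
apply/injectiveP; rewrite /injectiveb /dinjectiveb /image_mem labE.
exact: gadget_labels_uniq.
Qed.

Lemma lab_surj d a : a \in gadget_labels d -> exists v : vertex (gg d), lab v = a.
Proof. by rewrite /gadget_labels -labE => /mapP[v _ ->]; exists v. Qed.

Lemma sum_lab (R : nmodType) d (P : pred label) (F : label -> R) :
  \sum_(v : vertex (gg d) | P (lab v)) F (lab v) = \sum_(a <- gadget_labels d | P a) F a.
Proof. by rewrite /gadget_labels -labE big_map big_enum_cond. Qed.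

(** * The upper bound: a stabilizer from a set of vertices *)

Definition covered (P : pred nat) (e : nat * nat) := P e.1 && P e.2.

(* [m - k] of the [x_e], among them all those whose edge [P] does not cover, are matched to the
   absorbers.  With [k = 0] no [x_e] is exposed, so the absorbers can have [y = 1/2], at no cost. *)
Lemma gadget_upper (R : realType) d (P : pred nat) k :
  (k <= count (covered P) (es d))%N -> size (zs d) = (size (es d) - k)%N ->
  exists2 c : weighting R (gg d), frac_additive_stabilizer c &
    \sum_(e in edges (gg d)) c e =
      (if k == 0%N then 0 else 2^-1) * (size (zs d))%:R +
      2^-1 * (size (ts d))%:R * (count P (us d))%:R.
Proof.
move=> kle zsE.
(* The edges covered by [P] come first and number at least [k], so dropping [k] edges leaves every
   uncovered one in [E], the list of edges whose vertices are matched to absorbers. *)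
pose es' := [seq e <- es d | covered P e] ++ [seq e <- es d | predC (covered P) e].
have es'P : perm_eq es' (es d) by apply/permPl/perm_filterC.
pose E := drop k es'.
have E_uniq : uniq E by apply: drop_uniq; rewrite (perm_uniq es'P) es_uniq.
have Ees e : e \in E -> e \in es d by move=> /mem_drop; rewrite (perm_mem es'P).
have Esz : size E = size (zs d) by rewrite size_drop (perm_size es'P) zsE.
have notE e : e \in es d -> e \notin E -> (k != 0)%N && covered P e.
  rewrite -(perm_mem es'P) -(cat_take_drop k es') mem_cat -/E => /orP[|->//].
  move=> he _; apply/andP; split; first by apply: contraTneq he => ->; rewrite take0.
  move: he; rewrite /es' take_cat size_filter; case: ltnP => h.
    by move=> /mem_take; rewrite mem_filter => /andP[].
  have -> : (k - count (covered P) (es d) = 0)%N by lia.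
  by rewrite take0 cats0 mem_filter => /andP[].
pose dl : R := if k == 0%N then 0 else 2^-1.
have dl0 : 0 <= dl by rewrite /dl; case: ifP => _; lra.
(* An exposed edge vertex has value 0, so its neighbours need 1: the absorbers, and the ports of
   both ends of the edge, which lie in [P] because the edge is covered. *)
pose y (a : label) : R := match a with
  | LZ _ => 2^-1 + dl
  | LX p q => if (p, q) \in E then 2^-1 else 0
  | LQ u i j c => if is_port j c && P u then 1 else 2^-1 end.
pose mate (a : label) := match a with
  | LZ z => let e := nth (0, 0)%N E (index z (zs d)) in LX e.1 e.2
  | LX p q => if (p, q) \in E then LZ (nth 0%N (zs d) (index (p, q) E)) else a
  | LQ u i j c => LQ u i j (~~ c) end.
have idxE z : z \in zs d -> nth (0, 0)%N E (index z (zs d)) \in E.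
  by move=> hz; rewrite mem_nth // Esz index_mem.
have mate_in a : a \in gadget_labels d -> mate a \in gadget_labels d.
  rewrite !mem_labels; case: a => [z|p q|u i j c] //=.
    by move=> /idxE /Ees; case: (nth _ _ _).
  case: ifP => // hE he; rewrite /= mem_nth // -Esz index_mem //.
have mateK a : a \in gadget_labels d -> mate (mate a) = a.
  rewrite mem_labels; case: a => [z|p q|u i j c] //= h; last by rewrite negbK.
    rewrite -surjective_pairing idxE // index_uniq ?Esz ?index_mem //.
    by rewrite nth_index.
  case: ifP => hE /=; last by rewrite hE.
  by rewrite index_uniq ?zs_uniq -?Esz ?index_mem // nth_index.
have mate_adj a : a \in gadget_labels d -> mate a != a -> lrel a (mate a).
  rewrite mem_labels; case: a => [z|p q|u i j c] //=.
    by case: ifP => //= _; rewrite eqxx.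
  by rewrite !eqxx xpair_eqE /= negb_and; case: c; rewrite orbT.
have y0 a : 0 <= y a by case: a => [z|p q|u i j c] /=; try case: ifP => _; lra.
have yX p q a : (p, q) \in es d -> lrel (LX p q) a -> 1 <= y (LX p q) + y a.
  move=> he; case: a => [z|//|u i j c] /=.
    case: ifP => [_ _|/negbT /(notE _ he) /andP[/negbTE k0 _] _]; first lra.
    by rewrite /dl k0; lra.
  move=> /andP[-> /=]; case: ifP => [_ _|/negbT /(notE _ he) /andP[_ /andP[/= hp hq]]].
    by case: ifP => _; lra.
  by move=> /orP[]/eqP->; rewrite ?hp ?hq; lra.
have yadj a b : a \in gadget_labels d -> b \in gadget_labels d -> lrel a b -> 1 <= y a + y b.
  rewrite !mem_labels; case: a b => [z|p q|u i j c] b //=.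
  - by case: b => // p q _ he _; rewrite addrC; exact: (yX p q (LZ z)).
  - by move=> he _ h; exact: (yX p q b).
  - case: b => [//|p q|u' i' j' c'] _ he h.
      by rewrite addrC; exact: (yX p q (LQ u i j c)).
    by rewrite /=; do 2 case: ifP => _; lra.
(* The involution on labels is carried over to vertices; the default [v] is never reached, since
   [mate] preserves the set of labels. *)
pose mt (v : vertex (gg d)) := odflt v [pick v' | lab v' == mate (lab v)].
have mtE v : lab (mt v) = mate (lab v).
  rewrite /mt; case: pickP => [v' /eqP //|h].
  by have [v' /eqP] := lab_surj (mate_in _ (lab_in v)); rewrite h.
have mt_fix v : (mt v == v) = (mate (lab v) == lab v) by rewrite -(inj_eq (@lab_inj d)) mtE.
have [|||||c hc sumc] := @additive_stabilizer_of_mate R (gg d) (fun v => y (lab v)) mt.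
- by move=> v; apply: (@lab_inj d); rewrite !mtE mateK ?lab_in.
- by move=> v; rewrite mt_fix adjE mtE => /mate_adj; apply; exact: lab_in.
- by move=> v; exact: y0.
- by move=> u v; rewrite adjE => /yadj; apply; exact: lab_in.
- move=> v /eqP; rewrite mt_fix; case: (lab v) => [z|p q|u i j c] //=.
    by case: ifP => //= _; case: eqP.
  by case: c => /eqP [].
exists c => //; rewrite sumc -/dl.
under eq_bigl => v do rewrite mt_fix.
rewrite (@sum_lab _ d (fun a => mate a != a) (fun a => y a - 2^-1)) /gadget_labels /labels.
rewrite !big_cat !big_map /= [X in _ + (X + _)]big1 ?add0r; last first.
  by move=> [p q]; rewrite /=; case: ifP => [_ _|]; rewrite ?subrr ?eqxx.
congr (_ + _).
  under eq_bigr do rewrite addrAC subrr add0r.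
  by rewrite big_const_seq count_predT iter_addr_0 mulr_natr.
(* Vertices with [y = 2^-1] contribute nothing, so each clique of a vertex in [P] costs [2^-1], at
   its port. *)
transitivity (\sum_(x <- q_index (us d) (ts d) (js d))
    if is_port x.2.2.1 x.2.2.2 && P x.1 then 2^-1 else 0 : R).
  rewrite big_mkcond; apply: eq_bigr => -[u [i [j b]]] _ /=.
  have -> : LQ u i j (~~ b) != LQ u i j b by case: b; apply/eqP => -[].
  by case: ifP => _; lra.
rewrite big_allpairs /=; under eq_bigr => u _ do rewrite big_allpairs /=.
have E1 u (i : nat) : i \in ts d -> \sum_(x <- [seq (j, c) | j <- js d, c <- [:: false; true]])
    (if is_port x.1 x.2 && P u then 2^-1 else 0) = if P u then 2^-1 else 0 :> R.
  move=> _; rewrite big_allpairs /= (bigD1_seq 1%N) ?one_js ?js_uniq //=.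
  rewrite [X in _ + X]big1 ?addr0; last first.
    by move=> j /negbTE j1; rewrite /is_port big_cons big_seq1 /= j1 /= addr0.
  by rewrite big_cons big_seq1 /is_port /= addr0.
transitivity (\sum_(u <- us d) (size (ts d))%:R * (if P u then 2^-1 else 0) : R).
  apply: eq_bigr => u _; rewrite big_seq; under eq_bigr => i hi do rewrite (E1 u i) //.
  by rewrite -big_seq big_const_seq count_predT iter_addr_0 mulr_natl.
rewrite -mulr_sumr -big_mkcond big_const_seq iter_addr_0 -[X in _ * X]mulr_natr.
by rewrite mulrCA mulrA.
Qed.

(** * The lower bound on the cost of a stabilizer *)

Definition in_clique (u i : nat) (a : label) : bool :=
  if a is LQ u' i' _ _ then (u' == u) && (i' == i) else false.

Definition clique (d : gadget) u i : {set vertex (gg d)} := [set v | in_clique u i (lab v)].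

Lemma cliqueP d u i (v : vertex (gg d)) :
  reflect (exists j c, lab v = LQ u i j c) (v \in clique d u i).
Proof.
rewrite inE; apply: (iffP idP) => [|[j [c ->]]]; last by rewrite /= !eqxx.
by case: (lab v) => //= u' i' j c /andP[/eqP-> /eqP->]; exists j, c.
Qed.

Lemma clique_adj d u i (v w : vertex (gg d)) :
  v \in clique d u i -> w \in clique d u i -> v != w -> adj v w.
Proof.
move=> /cliqueP[j [c E]] /cliqueP[j' [c' E']]; rewrite -(inj_eq (@lab_inj d)) adjE E E'.
by move=> h; rewrite /= !eqxx /=; apply: contraNneq h => -[-> ->].
Qed.

(** [lrel] lets an edge vertex meet a clique only at its port. *)
Lemma clique_closed d u i (v w : vertex (gg d)) : lab v != LQ u i 1 false ->
  v \in clique d u i -> adj v w -> w \in clique d u i.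
Proof.
move=> + /cliqueP[j [c E]]; rewrite adjE inE E {E}; case: (lab w) => //= [p q|u' i' j' c'].
  by case: c => //; rewrite /is_port ?andbF // andbT => h /andP[/eqP j1]; rewrite j1 eqxx in h.
by move=> _ /and3P[/eqP-> /eqP-> _]; rewrite !eqxx.
Qed.

Lemma card_clique d u i : u \in us d -> i \in ts d -> #|clique d u i| = (size (js d)).*2.
Proof.
move=> hu hi; rewrite -sum1_card.
under eq_bigl => v do rewrite inE.
rewrite (@sum_lab _ d (in_clique u i) (fun=> 1%N)) sum1_count -size_filter.
have /perm_size -> : perm_eq [seq a <- gadget_labels d | in_clique u i a]
    [seq LQ u i j c | j <- js d, c <- [:: false; true]].
  apply: uniq_perm.
  - exact/filter_uniq/gadget_labels_uniq.
  - by apply: allpairs_uniq; rewrite ?js_uniq // => -[j c] [j' c'] _ _ /= [-> ->].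
  move=> a; rewrite mem_filter mem_labels; apply/idP/allpairsPdep.
    case: a => //= u' i' j c /andP[/andP[/eqP-> /eqP->] /and3P[_ _ hj]].
    by exists j, c; split=> //; case: c.
  by move=> [j [c [hj _ ->]]]; rewrite /= !eqxx hu hi.
by rewrite size_allpairs muln2.
Qed.


(** What complementary slackness gives for the weights [1 + c], with the cover inequality weakened
    from [1 + c] to [1]. *)
Record tight (R : realType) (G : sgraph) (c : weighting R G) (y : vertex G -> R)
    (M : {set {set vertex G}}) : Prop := Tight {
  tight_c0 : forall e, e \in edges G -> 0 <= c e;
  tight_cover : forall u v : vertex G, adj u v -> 1 <= y u + y v;
  tight_y0 : forall v, 0 <= y v;
  tight_edges : M \subset edges G;
  tight_triv : trivIset M;
  tight_eq : forall e, e \in M -> \sum_(v in e) y v = 1 + c e;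
  tight_out : forall v, v \notin cover M -> y v = 0
}.

Lemma stabilizer_tight (R : realType) (G : sgraph) (c : weighting R G) :
  frac_additive_stabilizer c -> exists y M, tight c y M.
Proof.
move=> [c0 /stableP[y [M [hy hM E]]]]; exists y, M.
have [h1 h2] := complementary_slackness hy hM E.
have [y0 yc] := hy; have [ME tM] := andP hM.
split=> // u v uv; apply: le_trans (yc _ _ uv).
by rewrite lerDl c0 // set2_edges.
Qed.

Definition inner (d : gadget) (M : {set {set vertex (gg d)}}) u i :=
  [set e in M | e \subset clique d u i].

Lemma card_cover_inner (R : realType) d (c : weighting R (gg d)) y M u i :
  tight c y M -> #|cover (inner M u i)| = (#|inner M u i|).*2.
Proof.
move=> t; have tP : trivIset (inner M u i).
  by apply: trivIsetS (tight_triv t); apply/subsetP => e; rewrite inE => /andP[].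
rewrite -(eqP tP) (eq_bigr (fun=> 2%N)) ?sum_nat_const ?muln2 // => e.
rewrite inE => /andP[/(subsetP (tight_edges t)) /edgesP[a [b [ab ->]]] _].
by rewrite cards2 adj_neq.
Qed.

Lemma cover_inner_sub d (M : {set {set vertex (gg d)}}) u i :
  cover (inner M u i) \subset clique d u i.
Proof. by apply/bigcupsP => e; rewrite inE => /andP[]. Qed.

Lemma innerP (R : realType) d (c : weighting R (gg d)) y M u i v :
  tight c y M -> v \in cover (inner M u i) ->
  exists w, [/\ v \in clique d u i, w \in clique d u i, adj v w,
     [set v; w] \in inner M u i & y v + y w = 1 + c [set v; w]].
Proof.
move=> t /bigcupP[e]; rewrite inE => /andP[eM eQ] ve.
have /(subsetP (tight_edges t)) /edgesP[a [b [ab E]]] := eM.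
have [w [E' vw]] : exists w, e = [set v; w] /\ adj v w.
  move: ve; rewrite E => /set2P[]->; first by exists b.
  by exists a; rewrite setUC adj_sym.
rewrite E' in eM eQ; exists w; split=> //.
- by apply: (subsetP eQ); rewrite set21.
- by apply: (subsetP eQ); rewrite set22.
- by rewrite inE eM eQ.
- by rewrite -sum_set2 ?adj_neq // (tight_eq t eM).
Qed.

Lemma cover_nonport (R : realType) d (c : weighting R (gg d)) y M u i v :
  tight c y M -> v \in clique d u i -> lab v != LQ u i 1 false ->
  v \in cover M -> v \in cover (inner M u i).
Proof.
move=> t vQ vp /bigcupP[e eM ve]; apply/bigcupP; exists e => //; rewrite inE eM /=.
have /(subsetP (tight_edges t)) /edgesP[a [b [ab E]]] := eM.
apply/subsetP => w we; have [-> //|vw] := eqVneq w v.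
apply: (clique_closed vp vQ); move: ve we vw; rewrite E.
by move=> /set2P[]-> /set2P[]->; rewrite ?eqxx // adj_sym.
Qed.

(* By parity the matching misses two vertices of the clique from inside, one of which is not the
   port; that one is exposed, so [y >= 1] on the rest of the clique. *)
Lemma damaged_clique_cost (R : realType) d (c : weighting R (gg d)) y M u i :
  tight c y M -> u \in us d -> i \in ts d -> cover (inner M u i) != clique d u i ->
  ((size (js d)).-1)%:R <= \sum_(e in edges (gg d)) c e.
Proof.
move=> t hu hi hne.
set Q := clique d u i; set P := inner M u i.
have PQ : cover P \subset Q := cover_inner_sub M u i.
have cP : #|cover P| = (#|P|).*2 := card_cover_inner u i t.
have cQ : #|Q| = (size (js d)).*2 := card_clique hu hi.
have lt : (#|cover P| < #|Q|)%N by apply: proper_card; rewrite properEneq hne.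
have [a [aQ aP ap]] : exists a, [/\ a \in Q, a \notin cover P & lab a != LQ u i 1 false].
  have : (1 < #|Q :\: cover P|)%N.
    rewrite cardsD (setIidPr PQ) cQ cP -doubleB -muln2.
    by move: lt; rewrite cP cQ ltn_double; lia.
  move=> /card_gt1P[a [b [/setDP[aQ aP] /setDP[bQ bP] ab]]].
  have [la|la] := eqVneq (lab a) (LQ u i 1 false); last by exists a.
  by exists b; split=> //; rewrite -la (inj_eq (@lab_inj d)) eq_sym.
have ya : y a = 0.
  by apply: (tight_out t); apply: contra aP; apply: (cover_nonport t).
have y1 b : b \in Q -> b != a -> 1 <= y b.
  move=> bQ ba; have := tight_cover t (clique_adj bQ aQ ba); by rewrite ya addr0.
have big : ((size (js d)).-1 <= #|P|)%N.
  have [p lp] : exists p : vertex (gg d), lab p = LQ u i 1 false.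
    by apply: lab_surj; rewrite mem_labels hu hi one_js.
  (* With [r = size (js d)], the remaining [2 r - 2] vertices have [y >= 1], so they are matched,
     and inside the clique; this takes at least [r - 1] edges. *)
  have : Q :\ a :\ p \subset cover P.
    apply/subsetP => b /setD1P[bp /setD1P[ba bQ]].
    have hb : lab b != LQ u i 1 false by rewrite -lp (inj_eq (@lab_inj d)).
    apply: (cover_nonport t) => //; apply/negPn/negP => /(tight_out t) yb.
    by have := y1 b bQ ba; rewrite yb; lra.
  move=> /subset_leq_card; rewrite cP.
  have := cardsD1 p (Q :\ a); have := cardsD1 a Q; rewrite aQ cQ.
  by case: (p \in _) => /=; lia.
apply: (@le_trans _ _ (#|P|%:R)); first by rewrite ler_nat.
rewrite -sumr_const.
apply: (@le_trans _ _ (\sum_(e in P) c e)); last first.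
  apply: ler_sum_sub; last exact: (tight_c0 t).
  by move=> e; rewrite inE => /andP[/(subsetP (tight_edges t))].
(* Both ends of an inner edge have [y >= 1], so tightness gives [1 + c e >= 2]. *)
apply: ler_sum => e eP.
have /set0Pn[v ve] : e != set0.
  move: eP; rewrite inE => /andP[/(subsetP (tight_edges t)) /edgesP[b [b' [_ ->]]] _].
  by apply/set0Pn; exists b; rewrite set21.
have vP : v \in cover P by apply/bigcupP; exists e.
have [w [vQ wQ vw eP' E]] := innerP t vP.
have EE : e = [set v; w].
  apply/eqP; apply: contraTT isT => ne.
  have /trivIsetP/(_ e [set v; w]) := tight_triv t.
  move: (eP) (eP'); rewrite !inE => /andP[eM _] /andP[eM' _] /(_ eM eM' ne).
  by move=> /pred0P/(_ v) /=; rewrite ve set21.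
have wP : w \in cover P by apply/bigcupP; exists e; rewrite ?EE ?set22 // -EE.
have va : v != a by apply: contraNneq aP => <-.
have wa : w != a by apply: contraNneq aP => <-.
have := y1 v vQ va; have := y1 w wQ wa; move: E; rewrite EE; lra.
Qed.

(* If the mate [q] of the port has [y q >= 1/3], their edge works; otherwise [y > 2/3] on the
   other vertices of the clique. *)
Lemma saturated_clique_edge (R : realType) d (c : weighting R (gg d)) y M u i p :
  tight c y M -> u \in us d -> i \in ts d -> (1 < size (js d))%N ->
  cover (inner M u i) = clique d u i ->
  p \in clique d u i -> 1 <= y p ->
  exists v w, [/\ v \in clique d u i, w \in clique d u i, adj v w & 1 <= 3 * c [set v; w]].
Proof.
move=> t hu hi hj Qc pQ yp; rewrite -Qc in pQ.
have [q [_ qQ pq pqP E]] := innerP t pQ.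
have [le|gt] := lerP (3^-1) (y q).
  exists p, q; split=> //; first by rewrite -Qc.
  lra.
(* The clique has at least four vertices, so some [r] lies outside [[set p; q]]; its mate [s]
   differs from [q] because [M] is disjoint. *)
have [r /setDP[rQ]] : exists r, r \in clique d u i :\: [set p; q].
  apply/set0Pn; rewrite -card_gt0 cardsD.
  have := subset_leq_card (subsetIr (clique d u i) [set p; q]).
  by rewrite cards2 (card_clique hu hi); case: (_ != _); lia.
rewrite !inE negb_or => /andP[rp rq]; rewrite -Qc in rQ.
have [s [rQ' sQ rs rsP E']] := innerP t rQ.
have sq : s != q.
  apply: contraTneq isT => sq; move: rsP pqP; rewrite sq !inE => /andP[m1 _] /andP[m2 _].
  have ne : [set r; q] != [set p; q].
    apply/eqP => /setP/(_ r); rewrite !inE eqxx (negbTE rp) (negbTE rq); by [].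
  have /trivIsetP/(_ _ _ m1 m2 ne)/pred0P/(_ q) := tight_triv t.
  by rewrite /= !set22.
have h1 := tight_cover t (clique_adj rQ' qQ rq).
have h2 := tight_cover t (clique_adj sQ qQ sq).
by exists r, s; split=> //; lra.
Qed.

(** The condition mentions [c] alone, and neither [y] nor [M], so it can be tested on the output of
    the algorithm. *)
Definition heavy (R : realType) d (c : weighting R (gg d)) u i :=
  exists v w, [/\ v \in clique d u i, w \in clique d u i, adj v w & 1 <= 3 * c [set v; w]].

(* An [x_e] with [e] not covered by [S] is matched, and only an absorber can be its mate. *)
Lemma saturated_uncovered (R : realType) d (c : weighting R (gg d)) y M (S : pred nat) :
  tight c y M -> (1 < size (js d))%N ->
  (forall u i, u \in us d -> i \in ts d -> cover (inner M u i) = clique d u i) ->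
  (forall u, u \in us d -> (forall i, i \in ts d -> heavy c u i) -> S u) ->
  (count (predC (covered S)) (es d) <= size (zs d))%N.
Proof.
move=> t hj sat hS.
pose isU (a : label) := if a is LX p q then ~~ covered S (p, q) else false.
pose isZ (a : label) := if a is LZ _ then true else false.
pose U := [set v : vertex (gg d) | isU (lab v)].
pose Z := [set v : vertex (gg d) | isZ (lab v)].
have cU : #|U| = count (predC (covered S)) (es d).
  rewrite -sum1_card; under eq_bigl => v do rewrite inE.
  rewrite (@sum_lab _ d isU (fun=> 1%N)) sum1_count /gadget_labels /labels.
  rewrite !count_cat !count_map -[RHS]addn0 -[RHS]add0n; congr (_ + (_ + _))%N.
  - by rewrite (@eq_count _ _ pred0) ?count_pred0 // => -[].
  - by rewrite (@eq_count _ _ pred0) ?count_pred0 // => -[? [? [? ?]]].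
have cZ : #|Z| = size (zs d).
  rewrite -sum1_card; under eq_bigl => v do rewrite inE.
  rewrite (@sum_lab _ d isZ (fun=> 1%N)) sum1_count /gadget_labels /labels.
  rewrite !count_cat !count_map -[RHS]addn0 -[0%N in RHS]addn0; congr (_ + (_ + _))%N.
  - by rewrite (@eq_count _ _ pred0) ?count_pred0 // => -[].
  - by rewrite (@eq_count _ _ pred0) ?count_pred0 // => -[? [? [? ?]]].
rewrite -cU -cZ.
have mateU v : v \in U -> exists2 w, w \in Z & [set v; w] \in M.
  rewrite inE => vU.
  have [p [q [lv uncov]]] : exists p q, lab v = LX p q /\ ~~ covered S (p, q).
    by case: (lab v) vU => // p q h; exists p, q.
  have pq_es : (p, q) \in es d by have := lab_in v; rewrite mem_labels lv.
  have vM : v \in cover M.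
    (* If [v] were exposed, the ports next to it would have [y >= 1], so all cliques of [p] and [q]
       would be heavy and both ends would satisfy [S]. *)
    apply: contraNT uncov => /(tight_out t) yv.
    have hport u : u \in us d -> (u == p) || (u == q) -> S u.
      move=> hu upq; apply: hS => // i hi.
      have [x lx] : exists x : vertex (gg d), lab x = LQ u i 1 false.
        by apply: lab_surj; rewrite mem_labels hu hi one_js.
      apply: (saturated_clique_edge (p := x) t) => //; first exact: sat.
        by apply/cliqueP; exists 1%N, false.
      have vx : adj v x by rewrite adjE lv lx.
      by have := tight_cover t vx; rewrite yv add0r.
    have /andP[/= hp hq] := es_us pq_es.
    by rewrite /covered /= !hport // eqxx ?orbT.
  have /bigcupP[e eM ve] := vM.
  have /(subsetP (tight_edges t)) /edgesP[a [b [ab E]]] := eM.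
  have [w [E' vw]] : exists w, e = [set v; w] /\ adj v w.
    move: ve; rewrite E => /set2P[]->; first by exists b.
    by exists a; rewrite setUC adj_sym.
  rewrite E' in eM; exists w => //; rewrite inE.
  move: (vw); rewrite adjE lv; case lw : (lab w) => [||u i j b'] //=.
  (* A mate lying in a clique would already be matched inside that clique, against the disjointness
     of [M]. *)
  move=> _; have wQ : w \in clique d u i by apply/cliqueP; exists j, b'.
  have /and3P[hu hi _] : [&& u \in us d, i \in ts d & j \in js d].
    by have := lab_in w; rewrite mem_labels lw.
  rewrite -(sat u i hu hi) in wQ; have [x [_ xQ wx xP _]] := innerP t wQ.
  have ne : [set v; w] != [set w; x].
    apply: contraTneq xP => h; rewrite -h inE negb_and; apply/orP; right.
    apply/subsetPn; exists v; rewrite ?set21 //; apply/negP => /cliqueP[? [? ]].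
    by rewrite lv.
  have xM : [set w; x] \in M by move: xP; rewrite inE => /andP[].
  have /trivIsetP/(_ _ _ eM xM ne)/pred0P/(_ w) := tight_triv t.
  by rewrite /= set22 set21.
pose f v := odflt v [pick w | (w \in Z) && ([set v; w] \in M)].
have fP v : v \in U -> f v \in Z /\ [set v; f v] \in M.
  move=> /mateU[w wZ vwM]; rewrite /f; case: pickP => [x /andP[]//|/(_ w)].
  by rewrite wZ vwM.
have finj : {in U &, injective f}.
  move=> v v' vU v'U ff; apply/eqP; apply: contraTT isT => vv'.
  have [fZ fM] := fP v vU; have [_ fM'] := fP v' v'U; rewrite -ff in fM'.
  have ne : [set v; f v] != [set v'; f v].
    apply/eqP => /setP/(_ v); rewrite !inE eqxx (negbTE vv') /= => /esym/eqP vf.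
    by move: fZ vU; rewrite -vf !inE; case: (lab v).
  have /trivIsetP/(_ _ _ fM fM' ne)/pred0P/(_ (f v)) := tight_triv t.
  by rewrite /= !set22.
rewrite -(card_in_imset finj); apply: subset_leq_card.
by apply/subsetP => _ /imsetP[v /fP[h _] ->].
Qed.

(** Cliques with different indices are disjoint, so choosing a heavy edge in each of them gives
    distinct edges, each of cost at least 1/3. *)
Lemma heavy_cost (R : realType) d (c : weighting R (gg d)) (S : pred nat) :
  (forall e, e \in edges (gg d) -> 0 <= c e) ->
  (forall u i, u \in us d -> i \in ts d -> S u -> heavy c u i) ->
  (count S (us d) * size (ts d))%:R <= 3 * \sum_(e in edges (gg d)) c e.
Proof.
move=> c0 hS.
pose g (x : nat * nat) := odflt set0 [pick e in edges (gg d) |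
  (e \subset clique d x.1 x.2) && (1 <= 3 * c e)].
pose L := [seq (u, i) | u <- [seq u <- us d | S u], i <- ts d].
have gP x : x \in L ->
    [/\ g x \in edges (gg d), g x \subset clique d x.1 x.2 & 1 <= 3 * c (g x)].
  move=> /allpairsP[[u i] /= [hu hi ->]] /=.
  move: hu; rewrite mem_filter => /andP[Su hu].
  have [v [w [vQ wQ vw h]]] := hS u i hu hi Su.
  rewrite /g; case: pickP => [e /and3P[] //|/(_ [set v; w]) /=].
  by rewrite set2_edges vw h andbT /= subUset !sub1set vQ wQ.
have ginj : {in L &, injective g}.
  move=> [u i] [u' i'] /gP[gE /= gQ _] /gP[_ /= gQ' _] E.
  have /edgesP[v [w [_ gvw]]] := gE.
  have vQ : v \in clique d u i by apply: (subsetP gQ); rewrite gvw set21.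
  have vQ' : v \in clique d u' i' by apply: (subsetP gQ'); rewrite -E gvw set21.
  have [j [b lv]] := cliqueP _ _ _ vQ; have [j' [b']] := cliqueP _ _ _ vQ'.
  by rewrite lv => -[-> ->].
have uL : uniq L.
  apply: allpairs_uniq; rewrite ?filter_uniq ?us_uniq ?ts_uniq //.
  by move=> [? ?] [? ?].
have ug : uniq [seq g x | x <- L] by rewrite map_inj_in_uniq.
have -> : (count S (us d) * size (ts d))%N = size [seq g x | x <- L].
  by rewrite size_map size_allpairs size_filter.
rewrite -sum1_size natr_sum mulr_sumr big_map.
apply: (@le_trans _ _ (\sum_(x <- L) 3 * c (g x))).
  by rewrite big_seq [leRHS]big_seq; apply: ler_sum => x /gP[].
rewrite -(big_map g predT (fun e => 3 * c e)) big_uniq //=.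
apply: ler_sum_sub => [e /mapP[x /gP[h _ _] ->] //|e he].
by rewrite mulr_ge0 ?c0.
Qed.

(** The alternative is whether the matching saturates every clique from inside or leaves a damaged
    one. *)
Lemma gadget_lower (R : realType) d (c : weighting R (gg d)) (S : pred nat) :
  frac_additive_stabilizer c -> (1 < size (js d))%N ->
  (forall u, u \in us d -> (S u <-> forall i, i \in ts d -> heavy c u i)) ->
  ((count S (us d) * size (ts d))%:R <= 3 * \sum_(e in edges (gg d)) c e) /\
  ((count (predC (covered S)) (es d) <= size (zs d))%N \/
   ((size (js d)).-1)%:R <= \sum_(e in edges (gg d)) c e).
Proof.
move=> hc hj hS; split.
  by apply: heavy_cost; [case: hc | move=> u i hu hi /(hS u hu); exact].
have [y [M t]] := stabilizer_tight hc.
have [/allP sat|/allPn[u hu /allPn[i hi ne]]] := boolP (all (fun u => all (fun i =>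
    cover (inner M u i) == clique d u i) (ts d)) (us d)).
  left; apply: (saturated_uncovered t) => // u.
    by move=> i /sat/allP h /h /eqP.
  by move=> hu /(hS u hu).
by right; apply: damaged_clique_cost t hu hi ne.
Qed.

Local Open Scope nat_scope.

(** * The programs *)

Definition tand (a b : tree) := if truthy a then b else Leaf.
Definition tor (a b : tree) := if truthy a then tbool true else b.
Definition tnot (a : tree) := if truthy a then Leaf else tbool true.
Definition teq (a b : tree) := tnot (tor (tdrop a b) (tdrop b a)).

(** The head is a tag, a list of length 0, 1 or 2; the indices are suffixes, read through their
    lengths. *)
Definition lblZ (s : tree) := Node Leaf s.
Definition lblX (e : tree) := Node (Node Leaf Leaf) e.
Definition lblQ (u i j c : tree) :=
  Node (Node Leaf (Node Leaf Leaf)) (Node u (Node i (Node j c))).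

Definition trel_XQ (a b : tree) :=
  tand (teq (hd (tl (tl (tl b)))) (Node Leaf Leaf)) (tand (tnot (tl (tl (tl (tl b)))))
    (tor (teq (hd (tl b)) (hd (tl a))) (teq (hd (tl b)) (tl (tl a))))).

Definition trel_QQ (a b : tree) :=
  tand (teq (hd (tl a)) (hd (tl b))) (tand (teq (hd (tl (tl a))) (hd (tl (tl b))))
    (tnot (tand (teq (hd (tl (tl (tl a)))) (hd (tl (tl (tl b)))))
                (if truthy (tl (tl (tl (tl a)))) then tl (tl (tl (tl b)))
                 else tnot (tl (tl (tl (tl b)))))))).

Definition trel (a b : tree) :=
  if truthy (hd a) then
    if truthy (tl (hd a)) then
      if truthy (hd b) then
        if truthy (tl (hd b)) then trel_QQ a b else trel_XQ b a
      else Leaf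
    else if truthy (hd b) then
      if truthy (tl (hd b)) then trel_XQ a b else Leaf
    else tbool true
  else if truthy (hd b) then if truthy (tl (hd b)) then Leaf else tbool true else Leaf.

(** [s] and [s'] are suffixes of the matrix and of its current row, and stand for the vertices [i]
    and [j]. The test [tdrop s' s] says that [s'] is shorter, that is [i < j], so each edge is
    listed once. *)
Definition tedges (rows : tree) :=
  tflat (fun s => tflat (fun s' =>
    if truthy (tand (hd s') (tdrop s' s)) then Node (Node s s') Leaf else Leaf) (hd s)) rows.

(* Horner's rule on a binary numeral [v], capped by the length of [E]: if [acc] is [E] without its
   first [v] elements, then [tdrop acc E] has length [v] (or [lsize E] if that is smaller). *)
Definition tdrop_bits (E bs : tree) :=
  rfold (fun s acc => if truthy (hd s) then tl (tdrop (tdrop acc E) acc)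
                      else tdrop (tdrop acc E) acc) E bs.

(* One element for each of the [t = 3 m + 1] cliques of a vertex. *)
Definition tcopies (rows : tree) :=
  Node Leaf (tcat (tedges rows) (tcat (tedges rows) (tedges rows))).

(* One element for each of the [r = n t + 2] pairs of matched vertices of a clique. *)
Definition tpairs (rows : tree) := Node Leaf (Node Leaf (tflat (fun=> tcopies rows) rows)).

Definition tabsorbers (x : tree) := tdrop_bits (tedges (hd x)) (tl x).

Definition tlabels (x : tree) :=
  tcat (tmaps lblZ (tabsorbers x)) (tcat (tmaps (fun s => lblX (hd s)) (tedges (hd x)))
    (tflat (fun u => tflat (fun i => tflat (fun j =>
       Node (lblQ u i j Leaf) (Node (lblQ u i j (Node Leaf Leaf)) Leaf))
       (tpairs (hd x))) (tcopies (hd x))) (hd x))).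

Definition treduce (x : tree) :=
  tmaps (fun s => tmaps (fun s' => if truthy (trel (hd s) (hd s')) then Node Leaf Leaf else Leaf)
    (tlabels x)) (tlabels x).

(* Only meant for arguments of length at most 7. *)
Definition thalf (l : tree) :=
  if truthy (tl (tl (tl (tl (tl l))))) then Node Leaf (Node Leaf (Node Leaf Leaf))
  else if truthy (tl (tl (tl l))) then Node Leaf (Node Leaf Leaf)
  else if truthy (tl l) then Node Leaf Leaf else Leaf.

(* [tcompare] decides [b <= 3 a] from the carries [st - 1] of the subtraction [3 a - b], least
   significant bit first.  They lie between -1 and 2, and the last one is nonnegative if and only
   if [3 a - b] is. *)
Definition tcompare_carry (a b st : tree) :=
  let l := if truthy b then st else Node Leaf st in
  thalf (if truthy a then Node Leaf (Node Leaf (Node Leaf l)) else l).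

Definition tcompare_step (s : tree) :=
  Node (tl (hd s)) (Node (tl (hd (tl s)))
    (tcompare_carry (hd (hd s)) (hd (hd (tl s))) (tl (tl s)))).

Definition tcompare (a b : tree) :=
  tl (tl (rfold (fun _ => tcompare_step)
    (rfold (fun _ => tcompare_step) (Node a (Node b (Node Leaf Leaf))) a) b)).

Definition tin_clique (u i a : tree) :=
  tand (tl (hd a)) (tand (teq (hd (tl a)) u) (teq (hd (tl (tl a))) i)).

(** The length of [tdrop s ls] is the number of elements of [ls] before the suffix [s], hence the
    row index; [s'] gives the column in the same way. *)
Definition tentry (ls out s s' : tree) := hd (tdrop (tdrop s' ls) (hd (tdrop (tdrop s ls) out))).

Definition theavy (ls out u i : tree) :=
  thas (fun s => thas (fun s' =>
    tand (tin_clique u i (hd s)) (tand (tin_clique u i (hd s'))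
      (tand (trel (hd s) (hd s'))
         (tcompare (hd (tentry ls out s s')) (tl (tentry ls out s s')))))) ls) ls.

Definition tselected (x out u : tree) := tall (theavy (tlabels x) out u) (tcopies (hd x)).

Definition tuncovered (x out : tree) :=
  tflat (fun s => if truthy (tand (tselected x out (hd (hd s))) (tselected x out (tl (hd s))))
                  then Leaf else Node Leaf Leaf) (tedges (hd x)).

(* [tdrop] tests whether more edges are uncovered than there are absorbers; all the vertices of
   [H] are then output. *)
Definition textract (x out : tree) :=
  tmaps (fun u => if truthy (tor (tselected x out u) (tdrop (tabsorbers x) (tuncovered x out)))
                  then Node Leaf Leaf else Leaf) (hd x).

(** * Polynomial running time of the programs *)

Ltac polyt_base := cbv beta; lazymatch goal with
  | |- polyt id => exact: polyt_id
  | |- polyt (fun x => x) => exact: polyt_id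
  | |- polyt (fun _ => Leaf) => exact: polyt_leaf
  | |- polyt (fun _ => tbool _) => exact: polyt_tbool
  | |- polyt (fun x => Node (@?F x) (@?G x)) => apply: (@polyt_node F G)
  | |- polyt (fun x => hd (@?F x)) => apply: (@polyt_hd F)
  | |- polyt (fun x => tl (@?F x)) => apply: (@polyt_tl F)
  | |- polyt (fun x => if _ then _ else _) =>
      refine (@polyt_if (fun x => _) (fun x => _) (fun x => _) _ _ _)
  | |- polyt (fun x => tdrop (@?F x) (@?G x)) => apply: (@polyt_tdrop F G)
  | |- polyt (fun x => tcat (@?F x) (@?G x)) => apply: (@polyt_tcat F G)
  | |- polyt (fun x => tmaps (@?G x) (@?L x)) => apply: (@polyt_tmaps G L)
  | |- polyt (fun x => tflat (@?G x) (@?L x)) => apply: (@polyt_tflat G L)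
  | |- polyt (fun x => thas (@?G x) (@?L x)) => apply: (@polyt_thas G L)
  | |- polyt (fun x => tall (@?G x) (@?L x)) => apply: (@polyt_tall G L)
  | H : polyt ?A |- polyt (fun x => ?A (@?F x)) => apply: (@polyt_comp A F H)
  end.

Ltac polyt_tac0 := repeat polyt_base.

Lemma polyt_tand A B : polyt A -> polyt B -> polyt (fun x => tand (A x) (B x)).
Proof. move=> hA hB; rewrite /tand; polyt_tac0. Qed.

Lemma polyt_tor A B : polyt A -> polyt B -> polyt (fun x => tor (A x) (B x)).
Proof. move=> hA hB; rewrite /tor; polyt_tac0. Qed.

Lemma polyt_tnot A : polyt A -> polyt (fun x => tnot (A x)).
Proof. move=> hA; rewrite /tnot; polyt_tac0. Qed.

Lemma polyt_teq A B : polyt A -> polyt B -> polyt (fun x => teq (A x) (B x)).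
Proof.
by move=> hA hB; apply: polyt_tnot; apply: polyt_tor; polyt_tac0.
Qed.

Ltac polyt_logic := cbv beta; lazymatch goal with
  | |- polyt (fun x => tand (@?F x) (@?G x)) => apply: (@polyt_tand F G)
  | |- polyt (fun x => tor (@?F x) (@?G x)) => apply: (@polyt_tor F G)
  | |- polyt (fun x => tnot (@?F x)) => apply: (@polyt_tnot F)
  | |- polyt (fun x => teq (@?F x) (@?G x)) => apply: (@polyt_teq F G)
  | |- _ => polyt_base
  end.

Ltac polyt_tac1 := repeat polyt_logic.

Lemma polyt_trel A B : polyt A -> polyt B -> polyt (fun x => trel (A x) (B x)).
Proof. move=> hA hB; rewrite /trel /trel_QQ /trel_XQ; polyt_tac1. Qed.

Lemma polyt_tedges A : polyt A -> polyt (fun x => tedges (A x)).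
Proof. move=> hA; rewrite /tedges; polyt_tac1. Qed.

Lemma polyt_tdrop_bits A B : polyt A -> polyt B -> polyt (fun x => tdrop_bits (A x) (B x)).
Proof.
move=> hA hB; apply: (@polyt_ext (fun x => rfold ((fun x s acc =>
    if truthy (hd s) then tl (tdrop (tdrop acc (A x)) acc) else tdrop (tdrop acc (A x)) acc) x)
   (A x) (B x))) => //.
apply: (@polyt_rfold1 _ _ _ 0) => //; first by polyt_tac1.
move=> x s acc; rewrite addn0; have h := tsize_tdrop (tdrop acc (A x)) acc.
by case: ifP => // _; apply: leq_trans (tsize_tl _) h.
Qed.

Lemma polyt_tcopies A : polyt A -> polyt (fun x => tcopies (A x)).
Proof. by move=> hA; have h := polyt_tedges hA; rewrite /tcopies; polyt_tac1. Qed.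

Ltac polyt_gadget := cbv beta; lazymatch goal with
  | |- polyt (fun x => trel (@?F x) (@?G x)) => apply: (@polyt_trel F G)
  | |- polyt (fun x => tedges (@?F x)) => apply: (@polyt_tedges F)
  | |- polyt (fun x => tdrop_bits (@?F x) (@?G x)) => apply: (@polyt_tdrop_bits F G)
  | |- polyt (fun x => tcopies (@?F x)) => apply: (@polyt_tcopies F)
  | |- _ => polyt_logic
  end.

Ltac polyt_tac2 := repeat polyt_gadget.

Lemma polyt_tabsorbers A : polyt A -> polyt (fun x => tabsorbers (A x)).
Proof. by move=> hA; rewrite /tabsorbers; polyt_tac2. Qed.

Lemma polyt_tlabels A : polyt A -> polyt (fun x => tlabels (A x)).
Proof.
move=> hA; have h := polyt_tabsorbers hA.
by rewrite /tlabels /tpairs /lblZ /lblX /lblQ; polyt_tac2; exact: h.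
Qed.

Lemma polyt_treduce : polyt treduce.
Proof.
have h := polyt_tlabels polyt_id.
by apply: (@polyt_ext (fun x => treduce x)) => //; rewrite /treduce; polyt_tac2.
Qed.

(** The new carry comes from [thalf] and has size at most 7 whatever the state, and the numerals
    only shrink. *)
Lemma tsize_tcompare_step s : tsize (tcompare_step s) <= tsize s + 10.
Proof.
rewrite /= /tcompare_carry.
have h l : tsize (thalf l) <= 7 by rewrite /thalf; do 3 case: ifP => // _.
have := h (if truthy (hd (hd s)) then Node Leaf (Node Leaf (Node Leaf
   (if truthy (hd (hd (tl s))) then tl (tl s) else Node Leaf (tl (tl s)))))
   else (if truthy (hd (hd (tl s))) then tl (tl s) else Node Leaf (tl (tl s)))).
move: (tsize (thalf _)) => n hn.
case: s => [|a b] /=; first by lia.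
have := tsize_tl a; case: b => [|b e] /=; first by lia.
by have := tsize_tl b; lia.
Qed.

Lemma polyt_tcompare A B : polyt A -> polyt B -> polyt (fun x => tcompare (A x) (B x)).
Proof.
move=> hA hB; apply: polyt_tl; apply: polyt_tl.
have hs L I : polyt L -> polyt I -> polyt (fun x => rfold (fun _ => tcompare_step) (I x) (L x)).
  move=> hL hI; apply: (@polyt_rfold1 (fun _ _ => tcompare_step) I L 10) => //.
    by rewrite /tcompare_step /tcompare_carry /thalf; polyt_tac0.
  by move=> _ _ acc; exact: tsize_tcompare_step.
apply: (hs _ (fun x => rfold (fun _ => tcompare_step)
  (Node (A x) (Node (B x) (Node Leaf Leaf))) (A x))) => //.
by apply: hs => //; polyt_tac0.
Qed.

Lemma polyt_theavy A B C D : polyt A -> polyt B -> polyt C -> polyt D ->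
  polyt (fun x => theavy (A x) (B x) (C x) (D x)).
Proof.
move=> hA hB hC hD; rewrite /theavy /tin_clique /tentry; polyt_tac2.
by apply: (@polyt_tcompare (fun y => _) (fun y => _)); polyt_tac2.
Qed.

Lemma polyt_tselected A B C : polyt A -> polyt B -> polyt C ->
  polyt (fun x => tselected (A x) (B x) (C x)).
Proof.
move=> hA hB hC; rewrite /tselected; polyt_tac2.
by apply: (@polyt_theavy (fun y => _) (fun y => _) (fun y => _) (fun y => _)); polyt_tac2;
  apply: (@polyt_tlabels (fun y => _)); polyt_tac2.
Qed.

Lemma polyt_tuncovered A B : polyt A -> polyt B -> polyt (fun x => tuncovered (A x) (B x)).
Proof.
by move=> hA hB; rewrite /tuncovered; polyt_tac2;
  apply: (@polyt_tselected (fun y => _) (fun y => _) (fun y => _)); polyt_tac2.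
Qed.

Lemma polyt_textract : polyt (fun y => textract (hd y) (tl y)).
Proof.
rewrite /textract; polyt_tac2.
- by apply: (@polyt_tselected (fun y => _) (fun y => _) (fun y => _)); polyt_tac2.
- by apply: (@polyt_tabsorbers (fun y => _)); polyt_tac2.
- by apply: (@polyt_tuncovered (fun y => _) (fun y => _)); polyt_tac2.
Qed.

(** * Correctness of the programs *)

Lemma lst_enc s : lst (enc_list s) = s.
Proof. by elim: s => //= a s ->. Qed.

Lemma enc_lst t : enc_list (lst t) = t.
Proof. by elim: t => //= a _ b ->. Qed.

Lemma truthy_lsize t : truthy t = (0 < lsize t).
Proof. by case: t. Qed.

Lemma truthy_enc_bool b : truthy (enc_bool b) = b.
Proof. by case: b. Qed.

Fixpoint sufs (t : tree) : seq tree := if t is Node a b then t :: sufs b else [::].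

Lemma lst_tdrop a b : lst (tdrop a b) = drop (lsize a) (lst b).
Proof.
rewrite /lsize; elim: a => [|h _ a IHa] /=; first by rewrite drop0.
rewrite /tdrop /= -/(tdrop a b) -addn1 addnC -drop_drop -IHa.
by case: (tdrop a b) => //= ? ?; rewrite drop0.
Qed.

Lemma tdropE a b : tdrop a b = enc_list (drop (lsize a) (lst b)).
Proof. by rewrite -lst_tdrop enc_lst. Qed.

Lemma truthy_tdrop a b : truthy (tdrop a b) = (lsize a < lsize b).
Proof. by rewrite truthy_lsize {1}/lsize lst_tdrop size_drop subn_gt0. Qed.

Lemma lst_tcat a b : lst (tcat a b) = lst a ++ lst b.
Proof. by elim: a => //= h _ a IHa; rewrite /tcat /= -/(tcat a b) IHa. Qed.

Lemma tmapsE G l : tmaps G l = enc_list [seq G s | s <- sufs l].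
Proof. by elim: l => //= h _ l <-. Qed.

Lemma lst_tmaps G l : lst (tmaps G l) = [seq G s | s <- sufs l].
Proof. by rewrite tmapsE lst_enc. Qed.

Lemma lst_tflat G l : lst (tflat G l) = flatten [seq lst (G s) | s <- sufs l].
Proof. by elim: l => //= h _ l <-; rewrite -lst_tcat. Qed.

Lemma truthy_thas G l : truthy (thas G l) = has (fun s => truthy (G s)) (sufs l).
Proof. by elim: l => // h _ l IHl; rewrite /thas /= -/(thas G l) -IHl; case: (truthy (G _)). Qed.

Lemma truthy_tall G l : truthy (tall G l) = all (fun s => truthy (G s)) (sufs l).
Proof. by elim: l => // h _ l IHl; rewrite /tall /= -/(tall G l) -IHl; case: (truthy (G _)). Qed.

Lemma map_hd_sufs l : [seq hd s | s <- sufs l] = lst l.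
Proof. by elim: l => //= h _ l ->. Qed.

Lemma size_sufs l : size (sufs l) = lsize l.
Proof. by rewrite /lsize -map_hd_sufs size_map. Qed.

Lemma nth_sufs l i : i < lsize l -> nth Leaf (sufs l) i = enc_list (drop i (lst l)).
Proof.
rewrite /lsize; elim: l i => // h _ l IHl [|i] /=; first by rewrite enc_lst.
exact: IHl.
Qed.

Lemma sufs_ord l n : lsize l = n ->
  sufs l = [seq enc_list (drop i (lst l)) | i : 'I_n].
Proof.
move=> <-; apply: (@eq_from_nth _ Leaf); first by rewrite size_map size_enum_ord size_sufs.
move=> i; rewrite size_sufs => hi; rewrite nth_sufs // (nth_map (Ordinal hi)) ?size_enum_ord //.
by rewrite nth_enum_ord.
Qed.

Lemma hd_drop s i : hd (enc_list (drop i s)) = nth Leaf s i.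
Proof. by elim: s i => [|a s IHs] [|i] //=. Qed.

Lemma lsize_sufs l n : lsize l = n -> [seq lsize s | s <- sufs l] = [seq n - i | i : 'I_n].
Proof.
move=> h; rewrite (sufs_ord h) -map_comp; apply: eq_map => i /=.
by rewrite /lsize lst_enc size_drop -/(lsize l) h.
Qed.

Lemma lsize_sufs_iota l : [seq lsize s | s <- sufs l] = rev (iota 1 (lsize l)).
Proof.
elim: l => // h _ l IHl; have E : lsize (Node h l) = lsize l + 1 by rewrite addn1.
by rewrite [LHS]/= IHl E iotaD rev_cat addnC.
Qed.

Lemma lsize_sufs_uniq l : uniq [seq lsize s | s <- sufs l].
Proof. by rewrite lsize_sufs_iota rev_uniq iota_uniq. Qed.

Lemma truthy_tand a b : truthy (tand a b) = truthy a && truthy b.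
Proof. by rewrite /tand; case: (truthy a). Qed.

Lemma truthy_tor a b : truthy (tor a b) = truthy a || truthy b.
Proof. by rewrite /tor; case: (truthy a). Qed.

Lemma truthy_tnot a : truthy (tnot a) = ~~ truthy a.
Proof. by rewrite /tnot; case: (truthy a). Qed.

Lemma truthy_teq a b : truthy (teq a b) = (lsize a == lsize b).
Proof. by rewrite truthy_tnot truthy_tor !truthy_tdrop; lia. Qed.

Definition truthyE := (truthy_tand, truthy_tor, truthy_tnot, truthy_teq, truthy_tdrop,
  truthy_thas, truthy_tall, truthy_enc_bool).

Definition decode_label (t : tree) : label :=
  if truthy (hd t) then
    if truthy (tl (hd t)) then
      LQ (lsize (hd (tl t))) (lsize (hd (tl (tl t)))) (lsize (hd (tl (tl (tl t)))))
         (truthy (tl (tl (tl (tl t)))))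
    else LX (lsize (hd (tl t))) (lsize (tl (tl t)))
  else LZ (lsize (tl t)).

Lemma truthy_trel a b : truthy (trel a b) = lrel (decode_label a) (decode_label b).
Proof.
rewrite /trel /decode_label; case: (truthy (hd a)); case: (truthy (hd b));
  try case: (truthy (tl (hd a))); try case: (truthy (tl (hd b))) => //=;
  rewrite /trel_QQ /trel_XQ !truthyE /is_port ?andbA //.
by congr (_ && ~~ _); rewrite xpair_eqE; congr (_ && _);
  case: (truthy (tl (tl (tl (tl a))))) => //; rewrite ?truthyE; case: (truthy _).
Qed.

Lemma truthy_tin_clique u i a :
  truthy (tin_clique u i a) = in_clique (lsize u) (lsize i) (decode_label a).
Proof.
rewrite /tin_clique /decode_label !truthyE.
by case: (hd a) => [|b [|b' b'']].
Qed.

(** The doubling step of the capped Horner rule; when [v] exceeds the length of [s], both sides are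
    empty. *)
Lemma drop_double_val (T : Type) (s : seq T) v :
  drop (size s - size (drop v s)) (drop v s) = drop v.*2 s.
Proof.
rewrite size_drop drop_drop; case: (leqP v (size s)) => h.
  by rewrite subKn // addnn.
by rewrite !drop_oversize //; lia.
Qed.

Lemma lst_tdrop_bits E bs : lst (tdrop_bits E (enc_bits bs)) = drop (bits_val bs) (lst E).
Proof.
elim: bs => [|b bs IHbs]; first by rewrite drop0.
rewrite /tdrop_bits /= -/(tdrop_bits E (enc_bits bs)) truthy_enc_bool.
set r := tdrop_bits _ _ in IHbs *.
have h : lst (tdrop (tdrop r E) r) = drop (bits_val bs).*2 (lst E).
  rewrite lst_tdrop /lsize lst_tdrop size_drop /lsize IHbs; exact: drop_double_val.
case: b => //=; rewrite -drop_drop -h.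
by case: (tdrop _ r) => //= ? ?; rewrite drop0.
Qed.

Lemma lsize_thalf l : lsize l < 8 -> lsize (thalf l) = (lsize l)./2.
Proof.
rewrite /lsize /thalf.
by do 8 (case: l => [//|? l] /=); lia.
Qed.

Lemma lsize_tcompare_carry (a b : bool) st : lsize st < 4 ->
  lsize (tcompare_carry (enc_bool a) (enc_bool b) st) = (3 * a + ~~ b + lsize st)./2.
Proof.
move=> h; rewrite /tcompare_carry !truthy_enc_bool lsize_thalf.
  by case: a; case: b; rewrite /lsize /=; lia.
by case: a; case: b; move: h; rewrite /lsize /=; lia.
Qed.

Definition compare_state (a b : seq bool) (st : tree) := Node (enc_bits a) (Node (enc_bits b) st).

(** With the carry [st - 1], the right side says that [3 a - b] plus the carry is nonnegative.
    Exhausted numerals supply zero bits, so any number of steps that covers both lengths will do. *)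
Lemma tcompare_iter f a b st : lsize st < 4 -> size a <= f -> size b <= f ->
  truthy (tl (tl (iter f tcompare_step (compare_state a b st)))) =
  (bits_val b < 3 * bits_val a + lsize st).
Proof.
elim: f a b st => [|f IHf] a b st hst.
  by rewrite !leqn0 => /nilP-> /nilP->; rewrite /= truthy_lsize.
move=> ha hb; rewrite iterSr.
have -> : tcompare_step (compare_state a b st) =
  compare_state (behead a) (behead b)
    (tcompare_carry (enc_bool (head false a)) (enc_bool (head false b)) st).
  by case: a b {ha hb} => [|? ?] [|? ?].
rewrite IHf ?lsize_tcompare_carry //; first last.
- by case: b hb.
- by case: a ha.
- by move: hst; case: (head _ _); case: (head _ _) => /=; lia.
have hv s : bits_val s = head false s + (bits_val (behead s)).*2 by case: s.
by rewrite (hv a) (hv b); case: (head _ _); case: (head _ _) => /=; lia.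
Qed.

Lemma rfold_iter (f : tree -> tree) a l : rfold (fun _ => f) a l = iter (lsize l) f a.
Proof. by elim: l => //= h _ l ->. Qed.

Lemma tcompareP a b :
  truthy (tcompare (enc_bits a) (enc_bits b)) = (bits_val b <= 3 * bits_val a).
Proof.
rewrite /tcompare !rfold_iter -iterD tcompare_iter //; first last.
- by rewrite /lsize !lst_enc !size_map leq_addr.
- by rewrite /lsize !lst_enc !size_map leq_addl.
by rewrite /lsize /= addn1 ltnS.
Qed.

Lemma bits_val_mkseq k L : bits_val (mkseq (fun i => odd (k %/ 2 ^ i)) L) = k %% 2 ^ L.
Proof.
elim: L k => [|L IHL] k; first by rewrite modn1.
rewrite /mkseq /= expn0 divn1 -[1]addn0 iotaDl -map_comp.
have -> : [seq ((fun i => odd (k %/ 2 ^ i)) \o addn 1) i | i <- iota 0 L] =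
    mkseq (fun i => odd (k./2 %/ 2 ^ i)) L.
  by apply: eq_map => i /=; rewrite add1n expnS -divn2 divnMA.
rewrite IHL expnS -!divn2 -muln2 mulnC.
have := divn_eq k 2; rewrite modn2 => h.
have -> : k %% (2 * 2 ^ L) = odd k + 2 * (k %/ 2 %% 2 ^ L).
  rewrite {1}h {1}(divn_eq (k %/ 2) (2 ^ L)).
  rewrite mulnDl -mulnA (mulnC (2 ^ L)) -addnA modnMDl modn_small.
    by rewrite addnC mulnC.
  have : k %/ 2 %% 2 ^ L < 2 ^ L by rewrite ltn_mod expn_gt0.
  by case: (odd k) => /=; lia.
by [].
Qed.

Lemma bits_val_nat_bits k : bits_val (nat_bits k) = k.
Proof. by rewrite bits_val_mkseq modn_small // up_logP. Qed.

(** * The graph built by the reduction *)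

Lemma lrel_sym : symmetric lrel.
Proof.
case=> [z|p q|u i j c] [z'|p' q'|u' i' j' c'] //=.
by rewrite eq_sym (eq_sym i) (eq_sym (j, c)).
Qed.

Lemma lrel_irr : irreflexive lrel.
Proof. by case=> [z|p q|u i j c] //=; rewrite !eqxx. Qed.

Definition tree_label (x : tree) (v : 'I_(lsize (tlabels x))) : label :=
  decode_label (nth Leaf (lst (tlabels x)) v).

Definition reduced_graph (x : tree) : sgraph :=
  @SGraph (lsize (tlabels x)) (relpre (@tree_label x) lrel)
    (fun u v => lrel_sym _ _) (fun u => lrel_irr _).

Lemma map_nth_ord (T : Type) (f : tree -> T) l :
  [seq f (nth Leaf (lst l) i) | i : 'I_(lsize l)] = [seq f a | a <- lst l].
Proof.
by rewrite -[in RHS](mkseq_nth Leaf (lst l)) /mkseq -val_enum_ord -2!map_comp.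
Qed.

Lemma treduceE x : treduce x = enc_graph (reduced_graph x).
Proof.
rewrite /enc_graph /enc_matrix /treduce tmapsE; congr enc_list.
pose f a b := if truthy (trel a b) then Node Leaf Leaf else Leaf.
transitivity [seq enc_list [seq f a b | b <- lst (tlabels x)] | a <- lst (tlabels x)].
  rewrite -!map_hd_sufs -map_comp; apply: eq_map => s /=.
  by rewrite tmapsE -map_comp.
rewrite -map_nth_ord; apply: eq_map => i; congr enc_list.
by rewrite -map_nth_ord; apply: eq_map => j; rewrite /f truthy_trel.
Qed.

Definition edge_code (e : tree) := (lsize (hd e), lsize (tl e)).

Lemma map_flatten_map (A B C : Type) (f : B -> C) (g : A -> seq B) s :
  [seq f b | b <- flatten [seq g a | a <- s]] = flatten [seq map f (g a) | a <- s].
Proof. by rewrite map_flatten -map_comp. Qed.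

Lemma tlabelsE x : [seq decode_label a | a <- lst (tlabels x)] =
  labels [seq lsize s | s <- sufs (tabsorbers x)]
         [seq edge_code e | e <- lst (tedges (hd x))]
         [seq lsize s | s <- sufs (hd x)]
         [seq lsize s | s <- sufs (tcopies (hd x))]
         [seq lsize s | s <- sufs (tpairs (hd x))].
Proof.
rewrite /tlabels !lst_tcat !map_cat !lst_tmaps /labels; congr (_ ++ (_ ++ _)).
- by rewrite -!map_comp.
- by rewrite -map_hd_sufs -!map_comp.
rewrite lst_tflat /q_index map_allpairs map_flatten_map -map_comp.
congr flatten; apply: eq_map => u; rewrite /comp; cbv beta.
rewrite lst_tflat map_allpairs map_flatten_map -map_comp.
congr flatten; apply: eq_map => i; rewrite /comp; cbv beta.
rewrite lst_tflat map_allpairs map_flatten_map -map_comp.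
by congr flatten.
Qed.

Lemma tree_labelE x : [seq @tree_label x v | v <- enum 'I_(lsize (tlabels x))] =
  [seq decode_label a | a <- lst (tlabels x)].
Proof. exact: map_nth_ord. Qed.

Lemma lst_enc_graph H : lst (enc_graph H) =
  [seq enc_list [seq enc_bool (@adj H i j) | j : 'I_(nvert H)] | i : 'I_(nvert H)].
Proof. by rewrite lst_enc. Qed.

Lemma lsize_enc_graph H : lsize (enc_graph H) = nvert H.
Proof. by rewrite /lsize lst_enc_graph size_map size_enum_ord. Qed.

Definition edge_pairs (H : sgraph) : seq (vertex H * vertex H) :=
  [seq p <- [seq (i, j) | i <- enum (vertex H), j <- enum (vertex H)] |
     @adj H p.1 p.2 && (p.1 < p.2)].

(* The length of the suffix that stands for the vertex [i] in the programs. *)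
Definition vertex_code (H : sgraph) (i : vertex H) : nat := nvert H - i.

Definition pair_code (H : sgraph) (p : vertex H * vertex H) : nat * nat :=
  (vertex_code p.1, vertex_code p.2).

Lemma flatten_allpairs_if (S T U : Type) (P : S -> T -> bool) (F : S -> T -> U) r s :
  flatten [seq flatten [seq if P i j then [:: F i j] else [::] | j <- s] | i <- r] =
  [seq F p.1 p.2 | p <- [seq (i, j) | i <- r, j <- s] & P p.1 p.2].
Proof.
elim: r => //= i r ->; rewrite filter_cat map_cat; congr (_ ++ _).
by elim: s => //= j s ->; case: ifP.
Qed.

Lemma tedgesE H : [seq edge_code e | e <- lst (tedges (enc_graph H))] =
  [seq pair_code p | p <- edge_pairs H].
Proof.
rewrite -(flatten_allpairs_if (fun i j => adj i j && (i < j))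
  (fun i j => pair_code (i, j))).
rewrite /tedges lst_tflat map_flatten_map (sufs_ord (lsize_enc_graph H)) -map_comp.
congr flatten; apply: eq_map => i; rewrite [LHS]/=.
rewrite hd_drop lst_enc_graph (nth_map i) ?size_enum_ord // nth_ord_enum.
have sz : lsize (enc_list [seq enc_bool (@adj H i j) | j : 'I_(nvert H)]) = nvert H.
  by rewrite /lsize lst_enc size_map size_enum_ord.
rewrite lst_tflat (sufs_ord sz) lst_enc map_flatten_map -map_comp.
congr flatten; apply: eq_map => j; rewrite [LHS]/=.
have lsz (T : Type) (g : 'I_(nvert H) -> tree) (k : 'I_(nvert H)) :
    lsize (enc_list (drop k [seq g l | l : 'I_(nvert H)])) = nvert H - k.
  by rewrite /lsize lst_enc size_drop size_map size_enum_ord.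
rewrite !truthyE hd_drop (nth_map j) ?size_enum_ord // nth_ord_enum truthy_enc_bool.
rewrite !(lsz unit); have -> : (nvert H - j < nvert H - i) = (i < j).
  by have := ltn_ord i; have := ltn_ord j; lia.
by case: ifP => // _; rewrite /= /edge_code /= !(lsz unit).
Qed.

Lemma lsize_sufs_enc_graph H :
  [seq lsize s | s <- sufs (enc_graph H)] = [seq vertex_code i | i : vertex H].
Proof. exact/lsize_sufs/lsize_enc_graph. Qed.

Lemma edge_pairs_uniq H : uniq (edge_pairs H).
Proof.
by apply/filter_uniq/allpairs_uniq; rewrite ?enum_uniq // => -[? ?] [? ?].
Qed.

Lemma mem_edge_pairs H p : (p \in edge_pairs H) = adj p.1 p.2 && (p.1 < p.2).
Proof.
rewrite mem_filter; case: p => i j; apply: andb_idr => _.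
by apply/allpairsPdep; exists i, j; rewrite !mem_enum.
Qed.

Lemma vertex_code_inj H : injective (@vertex_code H).
Proof.
rewrite /vertex_code => i j; have := ltn_ord i; have := ltn_ord j => hi hj h.
by apply: val_inj => /=; lia.
Qed.

Lemma pair_code_inj H : injective (@pair_code H).
Proof. by move=> [i j] [i' j'] [/vertex_code_inj -> /vertex_code_inj ->]. Qed.

(** Edges are two-element sets; ordering the ends by [p.1 < p.2] makes their correspondence with
    pairs bijective. *)
Lemma count_covered H (P : pred nat) :
  count (covered P) [seq pair_code p | p <- edge_pairs H] =
  #|[set e in edges H | e \subset [set i : vertex H | P (vertex_code i)]]|.
Proof.
rewrite count_map -size_filter.
set s := [seq x <- _ | _].
have us : uniq s by apply/filter_uniq/edge_pairs_uniq.
have -> : size s = #|[set p in s]| by rewrite cardsE; apply/esym/card_uniqP.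
have memS p : p \in s = [&& adj p.1 p.2, p.1 < p.2, P (vertex_code p.1) & P (vertex_code p.2)].
  by rewrite mem_filter mem_edge_pairs /covered /= andbC -andbA.
have finj : {in [set p in s] &, injective (fun p : vertex H * vertex H => [set p.1; p.2])}.
  move=> [i j] [i' j']; rewrite !inE !memS /= => /and4P[_ ij _ _] /and4P[_ ij' _ _] E.
  have : i \in [set i'; j'] by rewrite -E set21.
  have : j \in [set i'; j'] by rewrite -E set22.
  rewrite !inE => /orP[]/eqP ej /orP[]/eqP ei; rewrite ej ei in ij * => //.
  - by rewrite ltnn in ij.
  - by have := ltn_trans ij ij'; rewrite ltnn.
  - by rewrite ltnn in ij.
rewrite -(card_in_imset finj); apply: eq_card => e; rewrite !inE -[_ && _]/(_ && _).
apply/imsetP/andP => [[[i j]]|[]].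
  rewrite inE memS /= => /and4P[ij _ Pi Pj] ->; split.
    by apply/existsP; exists i; apply/existsP; exists j; rewrite ij eqxx.
  by rewrite subUset !sub1set !inE Pi Pj.
move=> /existsP[i /existsP[j /andP[ij /eqP->]]].
rewrite subUset !sub1set !inE => /andP[Pi Pj].
have [lt|gt|E] := ltngtP i j.
- by exists (i, j); rewrite // inE memS /= ij lt Pi Pj.
- by exists (j, i); rewrite /= 1?setUC // inE memS /= adj_sym ij gt Pi Pj.
- by move: ij; rewrite (val_inj E) adj_irr.
Qed.

Lemma count_vertex_codes H (P : pred nat) :
  count P [seq vertex_code i | i : vertex H] = #|[set i : vertex H | P (vertex_code i)]|.
Proof. by rewrite count_map cardsE cardE -size_filter enumT. Qed.

Definition cover_input (H : sgraph) (k : nat) : tree :=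
  Node (enc_graph H) (enc_bits (nat_bits k)).

Lemma one_in_lsizes l : 0 < lsize l -> 1 \in [seq lsize s | s <- sufs l].
Proof. by move=> h; rewrite lsize_sufs_iota mem_rev mem_iota; lia. Qed.

Lemma pair_codes_in H e : e \in [seq pair_code p | p <- edge_pairs H] ->
  (e.1 \in [seq vertex_code i | i : vertex H]) && (e.2 \in [seq vertex_code i | i : vertex H]).
Proof. by move=> /mapP[[i j] _ ->] /=; rewrite !map_f ?mem_enum. Qed.

Lemma reduced_labels H k (x := cover_input H k) :
  [seq @tree_label x v | v <- enum (vertex (reduced_graph x))] =
  labels [seq lsize s | s <- sufs (tabsorbers x)] [seq pair_code p | p <- edge_pairs H]
    [seq vertex_code i | i : vertex H] [seq lsize s | s <- sufs (tcopies (enc_graph H))]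
    [seq lsize s | s <- sufs (tpairs (enc_graph H))].
Proof. by rewrite tree_labelE tlabelsE tedgesE lsize_sufs_enc_graph. Qed.

Lemma pair_codes_uniq H : uniq [seq pair_code p | p <- edge_pairs H].
Proof. by rewrite map_inj_uniq ?edge_pairs_uniq //; exact: pair_code_inj. Qed.

Lemma vertex_codes_uniq H : uniq [seq vertex_code i | i : vertex H].
Proof. by rewrite map_inj_uniq ?enum_uniq //; exact: vertex_code_inj. Qed.

Definition reduced_gadget H k : gadget :=
  @Gadget _ _ _ _ _ (lsize_sufs_uniq _) (pair_codes_uniq H) (vertex_codes_uniq H)
    (lsize_sufs_uniq _) (lsize_sufs_uniq _)
    (one_in_lsizes (isT : 0 < lsize (tpairs (enc_graph H)))) (@pair_codes_in H)
    (reduced_graph (cover_input H k)) (@tree_label (cover_input H k))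
    (reduced_labels H k) (fun _ _ => erefl).

Lemma size_edge_codes H : size [seq pair_code p | p <- edge_pairs H] =
  lsize (tedges (enc_graph H)).
Proof. by rewrite -tedgesE size_map. Qed.

Lemma size_zs H k : size (zs (reduced_gadget H k)) = size (edge_pairs H) - k.
Proof.
rewrite size_map size_sufs /tabsorbers /lsize lst_tdrop_bits bits_val_nat_bits size_drop.
by rewrite -/(lsize _) -size_edge_codes size_map.
Qed.

(** The extra one keeps [t] positive, so that it can be cancelled from the final inequality. *)
Lemma size_ts H k : size (ts (reduced_gadget H k)) = (3 * size (edge_pairs H)).+1.
Proof.
have h : size (lst (tedges (enc_graph H))) = size (edge_pairs H).
  by rewrite -[LHS]/(lsize _) -size_edge_codes size_map.
by rewrite size_map size_sufs /tcopies /lsize /= !lst_tcat !size_cat !h mulSn mul2n -addnn.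
Qed.

(** [r >= 2] provides four vertices per clique, and [r - 1 >= n t] makes a damaged clique pay for
    all the vertices of [H]. *)
Lemma size_js H k : size (js (reduced_gadget H k)) =
  (nvert H * size (ts (reduced_gadget H k))).+2.
Proof.
rewrite !size_map !size_sufs /tpairs /lsize /= lst_tflat; congr _.+2.
rewrite size_flatten /shape -map_comp sumnE big_map.
by rewrite big_const_seq count_predT iter_addn_0 size_sufs lsize_enc_graph mulnC.
Qed.

(** * The extracted set of vertices *)

Definition heavyb (ls out : tree) (u i : nat) : bool :=
  has (fun s => has (fun s' =>
    [&& in_clique u i (decode_label (hd s)), in_clique u i (decode_label (hd s')),
        lrel (decode_label (hd s)) (decode_label (hd s')) &
        truthy (tcompare (hd (tentry ls out s s')) (tl (tentry ls out s s')))])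
    (sufs ls)) (sufs ls).

Lemma truthy_theavy ls out u i :
  truthy (theavy ls out u i) = heavyb ls out (lsize u) (lsize i).
Proof.
rewrite truthy_thas; apply: eq_has => s; rewrite truthy_thas; apply: eq_has => s'.
by rewrite truthy_tand truthy_tin_clique truthy_tand truthy_tin_clique truthy_tand truthy_trel.
Qed.

Definition selectedb (x out : tree) (u : nat) : bool :=
  all (heavyb (tlabels x) out u) [seq lsize s | s <- sufs (tcopies (hd x))].

Lemma truthy_tselected x out u : truthy (tselected x out u) = selectedb x out (lsize u).
Proof.
rewrite truthy_tall /selectedb all_map; apply: eq_all => i; exact: truthy_theavy.
Qed.

Lemma tentryE ls (M : 'I_(lsize ls) -> 'I_(lsize ls) -> tree) (v w : 'I_(lsize ls)) :
  tentry ls (enc_matrix M) (enc_list (drop v (lst ls))) (enc_list (drop w (lst ls))) = M v w.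
Proof.
have drop_ord (a : 'I_(lsize ls)) : lsize (tdrop (enc_list (drop a (lst ls))) ls) = a.
  rewrite /lsize lst_tdrop size_drop /lsize lst_enc size_drop subKn //.
  exact/ltnW/ltn_ord.
rewrite /tentry tdropE hd_drop drop_ord tdropE drop_ord hd_drop /enc_matrix lst_enc.
rewrite (nth_map v) ?size_enum_ord // nth_ord_enum lst_enc.
by rewrite (nth_map w) ?size_enum_ord // nth_ord_enum.
Qed.

Lemma has_sufs (P : pred tree) l :
  has P (sufs l) = [exists v : 'I_(lsize l), P (enc_list (drop v (lst l)))].
Proof.
rewrite (sufs_ord erefl) has_map; apply/hasP/existsP => [[v _ h]|[v h]]; exists v => //.
by rewrite mem_enum.
Qed.

(** Clearing the positive denominator turns [1 <= 3 * (num / den)] into [den <= 3 * num], which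
    [tcompare] decides on the numerals. *)
Lemma heavybP (R : realType) H k out (c : weighting R (gg (reduced_gadget H k))) u i :
  represents_weighting out c ->
  heavyb (tlabels (cover_input H k)) out u i <-> heavy c u i.
Proof.
move=> [num [den [-> hc]]].
set ls := tlabels (cover_input H k).
have E (v w : 'I_(lsize ls)) : lrel (tree_label v) (tree_label w) ->
    truthy (tcompare (enc_bits (num v w)) (enc_bits (den v w))) =
    (1 <= 3 * c [set v; w] :> R)%R.
  move=> vw; rewrite tcompareP; have [d0 ->] := hc v w vw.
  by rewrite mulrA ler_pdivlMr ?ltr0n // mul1r -natrM ler_nat.
rewrite /heavyb has_sufs; split.
  move=> /existsP[v]; rewrite has_sufs => /existsP[w].
  rewrite tentryE !hd_drop => /and4P[vQ wQ vw h].
  by exists v, w; split; rewrite ?inE // -E.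
move=> [v [w [vQ wQ vw h]]]; apply/existsP; exists v; rewrite has_sufs.
apply/existsP; exists w; rewrite tentryE !hd_drop.
by move: vQ wQ; rewrite !inE => vQ wQ; apply/and4P; split=> //; rewrite /= E.
Qed.

(** When [out] represents a stabilizer, [gadget_lower] shows that this happens only if its cost is
    at least [r - 1]. *)
Definition fallback (x out : tree) : bool :=
  lsize (tabsorbers x) <
    count (predC (covered (selectedb x out))) [seq edge_code e | e <- lst (tedges (hd x))].

Lemma truthy_fallback x out :
  truthy (tdrop (tabsorbers x) (tuncovered x out)) = fallback x out.
Proof.
rewrite truthy_tdrop; congr (_ < _); rewrite /lsize lst_tflat count_map -map_hd_sufs count_map.
elim: (sufs _) => //= s ss IHss; rewrite size_cat IHss; congr (_ + _).
by rewrite /tand !truthy_tselected /covered /=; case: (selectedb _ _ _);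
  rewrite ?truthy_tselected //; case: (selectedb _ _ _).
Qed.

Definition extracted (H : sgraph) (k : nat) (out : tree) : {set vertex H} :=
  [set i | selectedb (cover_input H k) out (vertex_code i) || fallback (cover_input H k) out].

Lemma textractE H k out : textract (cover_input H k) out =
  enc_bits [seq i \in extracted H k out | i <- enum 'I_(nvert H)].
Proof.
rewrite /textract tmapsE /enc_bits -map_comp (sufs_ord (lsize_enc_graph H)) -map_comp.
congr enc_list; apply: eq_map => i /=.
rewrite truthy_tor truthy_tselected truthy_fallback inE.
have -> : lsize (enc_list (drop i (lst (enc_graph H)))) = vertex_code i.
  by rewrite /lsize lst_enc size_drop -/(lsize _) lsize_enc_graph.
by case: (_ || _).
Qed.

(** * The approximation guarantee *)

Lemma reduced_upper (R : realType) H k (S0 : {set vertex H}) :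
  k <= #|[set e in edges H | e \subset S0]| ->
  exists2 c : weighting R (reduced_graph (cover_input H k)), frac_additive_stabilizer c &
    (\sum_(e in edges (reduced_graph (cover_input H k))) c e <=
     2 / 3 * ((size (ts (reduced_gadget H k)))%:R * #|S0|%:R))%R.
Proof.
move=> hS0; set d := reduced_gadget H k.
pose P u := [exists i in S0, vertex_code i == u].
have PS0 : [set i | P (vertex_code i)] = S0.
  apply/setP => i; rewrite inE; apply/existsP/idP => [[j /andP[jS /eqP/vertex_code_inj <-]] //|iS].
  by exists i; rewrite iS eqxx.
have [||c' hc' sumc'] := @gadget_upper R d P k.
- by rewrite count_covered PS0.
- by rewrite size_zs size_map.
have cP : count P (us d) = #|S0| by rewrite count_vertex_codes PS0.
exists c' => //; rewrite sumc' cP; set t := size (ts d).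
have ts0 : (0 <= t%:R * #|S0|%:R :> R)%R by rewrite mulr_ge0.
case: eqP => [_|/eqP k0]; first by rewrite mul0r add0r -mulrA; lra.
(* A set covering [k > 0] edges is nonempty, so [t #|S0| >= t >= 3 (m - k)]. The absorbers then cost
   at most a sixth of [t #|S0|] and the ports half of it, which makes 2/3. *)
have S0gt : 0 < #|S0|.
  rewrite card_gt0; apply: contraTneq hS0 => ->; rewrite -ltnNge.
  have -> : [set e in edges H | e \subset set0] = set0.
    apply/setP => e; rewrite !inE subset0; apply/andP => -[/existsP[u /existsP[v]]].
    by move=> /andP[_ /eqP->] /eqP/setP/(_ u); rewrite !inE eqxx.
  by rewrite cards0 lt0n.
have : ((3 * size (zs d))%:R <= (t * #|S0|)%:R :> R)%R.
  by rewrite ler_nat size_zs; apply: leq_trans (leq_pmulr t S0gt); rewrite /t size_ts; lia.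
by rewrite !natrM -mulrA; lra.
Qed.

Lemma coverage_reduction (R : realType) (f : R) H k out
    (c : weighting R (gg (reduced_gadget H k))) (S0 : {set vertex H}) :
  (1 <= f)%R -> (k <= #|[set e in edges H | e \subset S0]|) ->
  represents_weighting out c -> frac_additive_stabilizer c ->
  (forall c', frac_additive_stabilizer c' ->
     (\sum_(e in edges (gg (reduced_gadget H k))) c e <=
      f * \sum_(e in edges (gg (reduced_gadget H k))) c' e)%R) ->
  k <= #|[set e in edges H | e \subset extracted H k out]| /\
  ((#|extracted H k out|)%:R <= 2 * f * (#|S0|)%:R :> R)%R.
Proof.
move=> f1 hS0 hout hc hopt; set d := reduced_gadget H k; set x := cover_input H k.
set S := selectedb x out; set m := size (edge_pairs H); set t := size (ts d).
set C := (\sum_(e in _) c e)%R in hopt.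
have tE : t = (3 * m).+1 := size_ts H k.
have zE : size (zs d) = m - k := size_zs H k.
have jE : size (js d) = (nvert H * t).+2 := size_js H k.
have esz : size (es d) = m by rewrite size_map.
have lE : lsize (tabsorbers x) = size (zs d) by rewrite size_map size_sufs.
have [low1 low2] : ((count S (us d) * t)%:R <= 3 * C)%R /\
    ((count (predC (covered S)) (es d) <= size (zs d))%N \/ ((size (js d)).-1)%:R <= C)%R.
  apply: (@gadget_lower R d c S) => //.
  by move=> u _; split=> [/allP h i /h /(heavybP _ _ hout)|h] //;
    apply/allP => i /h /(heavybP _ _ hout).
have fbE : fallback x out = (size (zs d) < count (predC (covered S)) (es d)).
  by rewrite /fallback lE tedgesE.
have exE : extracted H k out = if fallback x out then setT
    else [set i | S (vertex_code i)].
  by apply/setP => i; rewrite /extracted -/x; case: (fallback x out); rewrite !inE ?orbT ?orbF.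
have C0 : (0 <= C)%R by apply: sumr_ge0 => e /(proj1 hc).
(* This makes [m - k] a true difference: at most [m - k] uncovered edges means at least [k] covered
   ones. *)
have km : k <= m.
  pose P u := [exists i in S0, vertex_code i == u].
  have -> : m = size (es d) by [].
  apply: leq_trans hS0 (leq_trans _ (count_size (covered P) (es d))).
  rewrite count_covered; apply: subset_leq_card; apply/subsetP => e; rewrite !inE.
  move=> /andP[-> /subsetP h]; apply/subsetP => i /h iS; rewrite inE.
  by apply/existsP; exists i; rewrite iS eqxx.
split.
  rewrite exE fbE; case: ltnP => h.
    apply: leq_trans hS0 (subset_leq_card _); apply/subsetP => e; rewrite !inE.
    by move=> /andP[-> _]; rewrite subsetT.
  rewrite -count_covered; have := count_predC (covered S) (es d).
  rewrite esz; move: h; rewrite zE /=; lia.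
(* If all vertices are output, then [n t <= r - 1 <= C]; otherwise this is the bound from the heavy
   cliques. *)
have tS : ((#|extracted H k out| * t)%:R <= 3 * C)%R.
  rewrite exE fbE; case: ltnP => h; last by rewrite -count_vertex_codes.
  case: low2 => [h'|]; first by move: h; rewrite ltnNge h'.
  rewrite cardsT card_ord jE /= => h'.
  have : ((nvert H * t)%:R <= (nvert H * t).+1%:R :> R)%R by rewrite ler_nat.
  by move: h' C0; move: (_%:R)%R (_%:R)%R => a b; lra.
have [c' hc' bound] := reduced_upper R hS0; rewrite -/t in bound.
have t0 : (0 < t%:R :> R)%R by rewrite ltr0n tE.
have f0 : (0 <= f)%R by lra.
have h := le_trans (hopt c' hc') (ler_wpM2l f0 bound).
(* After multiplication by [t], the bound follows from [3 C <= 3 f (2/3) t #|S0|]. *)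
rewrite -(ler_pM2r t0) -natrM; apply: le_trans tS _.
have -> : (2 * f * #|S0|%:R * t%:R = 3 * (f * (2 / 3 * (t%:R * #|S0|%:R))))%R by lra.
by rewrite ler_pM2l.
Qed.

Local Open Scope ring_scope.

Theorem theorem6 (R : realType) (f : R) (hf : 1 <= f)
  (hMFASP : poly_approx (MFASP R) f) :
  poly_approx (min_k_edge_coverage R) (2 * f).
Proof.
have [p [time hp]] := hMFASP.
have [p' [time' hp']] := reduction_runs p time polyt_treduce polyt_textract.
exists p', time' => -[H k].
have [out [t [run_out t_le approx]]] := hp (reduced_graph (cover_input H k)).
rewrite /= -treduceE in run_out t_le.
have [t' run' t'_le] := hp' _ _ _ run_out t_le.
exists (textract (cover_input H k) out), t'; split=> // -[S0 hS0].
(* The guarantee of the given algorithm presupposes a feasible stabilizer, which the upper bound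
   supplies. *)
have [c0 hc0 _] := reduced_upper R hS0.
have [c [hout hc hopt]] := approx (ex_intro _ c0 hc0).
exists (extracted H k out); split; first exact: textractE.
  by have [] := coverage_reduction hf hS0 hout hc hopt.
by move=> S hS; have [] := coverage_reduction hf hS hout hc hopt.
Qed.
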